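(* Let $\mathcal{G}=(\Omega,E)$ be a graph where $E$ is a reflexive linear ordering. Endow $\Omega$ with the order topology and $E\subseteq\Omega\times\Omega$ with the relative topology of the product topology. Consider a family $\phi=\{e^{A(u,v)}\}_{(u,v)\in E}$ of contractions on a Banach space $\mathcal{E}$, where $\{A(u,v)\}_{(u,v)\in E}$ is a norm-continuous additive family of (not necessarily commuting) bounded operators on $\mathcal{E}$ with geometric growth. Then the following hold. (a) If each $A(u,v)$ is dissipative (and $\{A(u,v)\}_{(u,v)\in E}$ has geometric growth), then there exist a Banach space $\tilde{\mathcal{E}}$, a strongly continuous divisible dynamical system $\{U(u,v)\}_{(u,v)\in E}$ on the graph $\mathcal{G}$ consisting of surjective isometries on $\tilde{\mathcal{E}}$, a surjective (linear) contraction $j:\tilde{\mathcal{E}}\to\mathcal{E}$ and a linear isometry $r:\mathcal{E}\to\tilde{\mathcal{E}}$ with $j\circ r=\mathbf{I}$, such that $j\,U(u,v)\,r=e^{A(u,v)}$ for all $(u,v)\in E$. (b) Suppose $\mathcal{E}$ is a unital (resp. commutative unital) C$^*$-algebra $\mathcal{A}$ and each $A(u,v)=L_{(u,v)}$, where $L_{(u,v)}$ is a self-adjoint map on $\mathcal{A}$ satisfying $L_{(u,v)}(1)=\mathbf{0}$ and $D_{L_{(u,v)}}(a,a)\ge\mathbf{0}$ for all $a\in\mathcal{A}$. If $\{L_{(u,v)}\}_{(u,v)\in E}$ has geometric growth, then there exist a unital (resp. commutative unital) C$^*$-algebra $\tilde{\mathcal{A}}$, a strongly continuous divisible dynamical system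 $\{U(u,v)\}_{(u,v)\in E}$ on the graph $\mathcal{G}$ consisting of ${}^*$-automorphisms of $\tilde{\mathcal{A}}$, a surjective unital ${}^*$-homomorphism $j:\tilde{\mathcal{A}}\to\mathcal{A}$ and an isometric positive unital linear map $r:\mathcal{A}\to\tilde{\mathcal{A}}$ with $j\circ r=\mathrm{id}_{\mathcal{A}}$, such that $j\,U(u,v)\,r=e^{L_{(u,v)}}$ for all $(u,v)\in E$.
   Context: A graph $\mathcal{G}=(\Omega,E)$ consists of a non-empty set $\Omega$ of nodes and a non-empty set $E\subseteq\Omega\times\Omega$ of edges. When $E$ is a reflexive linear ordering, write $u\preceq v$ for $(u,v)\in E$ and $\prec$ for its irreflexive part; the order topology on $\Omega$ is generated by the sets $\{u\in\Omega\mid u\prec v\}$ and $\{u\in\Omega\mid v\prec u\}$, $v\in\Omega$. A family $\{\psi(u,v)\}_{(u,v)\in E}$ of bounded operators on a Banach space is a divisible dynamical system on $\mathcal{G}$ if $\psi(u,u)=\mathbf{I}$ for all $u\in\Omega$ with $(u,u)\in E$, and $\psi(u,w)=\psi(u,v)\psi(v,w)$ for all $u,v,w\in\Omega$ with $(u,v),(v,w),(u,w)\in E$. It is strongly continuous if $(u,v)\mapsto\psi(u,v)\xi$ is norm-continuous on $E$ for each vector $\xi$ of the space. The family $\{A(u,v)\}_{(u,v)\in E}$ is norm-continuous if $E\ni(u,v)\mapsto A(u,v)$ is continuous in operator norm; it is additive if $A(u,w)=A(u,v)+A(v,w)$ for all edges $(u,v),(v,w),(u,w)\in E$. A superadditive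 length function on $\mathcal{G}$ is a continuous function $\ell:E\to[0,\infty)$ such that $\ell(u,u)=0$ whenever $(u,u)\in E$, and $\ell(u,w)\ge\ell(u,v)+\ell(v,w)$ whenever $(u,v),(v,w),(u,w)\in E$. The family $\{A(u,v)\}_{(u,v)\in E}$ has geometric growth if there is a superadditive length function $\ell$ on $\mathcal{G}$ with $\|A(u,v)\|\le\ell(u,v)$ for all $(u,v)\in E$. A duality section of a Banach space $\mathcal{E}$ with dual $\mathcal{E}'$ and bilinear pairing $\langle\cdot,\cdot\rangle:\mathcal{E}\times\mathcal{E}'\to\mathbb{C}$ is a (not necessarily linear) norm-preserving function $J:\mathcal{E}\to\mathcal{E}'$ with $\langle\xi,J(\xi)\rangle=\|\xi\|^2$ for all $\xi$. A bounded operator $A$ on $\mathcal{E}$ is dissipative if $\mathrm{Re}\langle A\xi,J(\xi)\rangle\le 0$ for all $\xi\in\mathcal{E}$, for some (equivalently, any) duality section $J$; equivalently, $e^{\alpha A}$ is a contraction for all $\alpha>0$. A linear map $L$ on a C$^*$-algebra is self-adjoint if it maps self-adjoint elements to self-adjoint elements. Its dissipation map is $D_L(a,b)=L(b^*a)-(L(b)^*a+b^*L(a))$. A linear map is positive if it maps positive elements to positive elements, and unital if it maps $1$ to $1$. $\mathbf{I}$ denotes the identity operator. *)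

(* Defs.v *)
From HB Require Import structures.
From mathcomp Require Import all_boot all_order all_algebra complex.
From mathcomp Require Import all_classical all_reals all_analysis.

Set Implicit Arguments.
Unset Strict Implicit.
Unset Printing Implicit Defensive.

Import Order.TTheory GRing.Theory Num.Theory.
Import numFieldNormedType.Exports.

Local Open Scope classical_set_scope.
Local Open Scope complex_scope.
Local Open Scope ring_scope.

(* Complex Banach spaces are the completeNormedModType's over R[i], R : realType.
   Their norms take values in R[i]; normR is the same norm read as a real. *)
Definition normR (R : realType) (V : normedModType R[i]) (x : V) : R :=
  complex.Re `|x|.

Section Operators.
Context {R : realType}.

Definition bounded_operator (V W : normedModType R[i]) (f : V -> W) :=
  exists M : R, forall x, normR (f x) <= M * normR x.

(* Only meaningful for bounded linear f: otherwise the set need not have a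
   supremum. *)
Definition opnorm (V W : normedModType R[i]) (f : V -> W) : R :=
  sup [set normR (f x) | x in [set x : V | normR x <= 1]].

Definition contractive (V W : normedModType R[i]) (f : V -> W) :=
  forall x, normR (f x) <= normR x.

Definition isometric (V W : normedModType R[i]) (f : V -> W) :=
  forall x, normR (f x) = normR x.

(* e^f is evaluated vector by vector: for bounded linear f on a Banach space
   the series sum_n f^n / n! converges absolutely in operator norm, so this
   pointwise sum is the value of its operator-norm sum. *)
Definition exp_operator (V : completeNormedModType R[i]) (f : V -> V) (x : V)
    : V :=
  limn (series (fun n => (n`!%:R : R[i])^-1 *: iter n f x)).

Definition duality_section (V : completeNormedModType R[i])
    (J : V -> {linear V -> R[i]^o}) :=
  forall x, [/\ bounded_operator (J x), opnorm (J x) = normR x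
              & J x x = `|x| ^+ 2].

Definition dissipative (V : completeNormedModType R[i]) (f : V -> V) :=
  exists2 J : V -> {linear V -> R[i]^o},
    duality_section J & forall x, complex.Re (J x (f x)) <= 0.

End Operators.

(* A family indexed by the edges of a graph (Omega, E) is a total function of
   two nodes, of which only the values on E are ever constrained. *)
Section Families.
Context {R : realType} {Omega : topologicalType} (E : set (Omega * Omega)).

Definition divisible_system (V : completeNormedModType R[i])
    (psi : Omega -> Omega -> {linear V -> V}) :=
  [/\ forall u v, E (u, v) -> bounded_operator (psi u v),
      forall u, E (u, u) -> psi u u =1 id
    & forall u v w, E (u, v) -> E (v, w) -> E (u, w) ->
        psi u w =1 psi u v \o psi v w].

Definition strongly_continuous (V : completeNormedModType R[i])
    (psi : Omega -> Omega -> {linear V -> V}) :=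
  forall x : V, {within E, continuous (fun p => psi p.1 p.2 x)}.

Definition norm_continuous (V : completeNormedModType R[i])
    (A : Omega -> Omega -> {linear V -> V}) :=
  forall p, E p ->
    (fun q => opnorm (fun x => A q.1 q.2 x - A p.1 p.2 x))
      @ within E (nbhs p) --> (0 : R).

Definition additive_family (V : completeNormedModType R[i])
    (A : Omega -> Omega -> {linear V -> V}) :=
  forall u v w, E (u, v) -> E (v, w) -> E (u, w) ->
    forall x, A u w x = A u v x + A v w x.

Definition superadditive_length (l : Omega -> Omega -> R) :=
  [/\ {within E, continuous (fun p => l p.1 p.2)},
      forall u v, E (u, v) -> 0 <= l u v,
      forall u, E (u, u) -> l u u = 0
    & forall u v w, E (u, v) -> E (v, w) -> E (u, w) ->
        l u v + l v w <= l u w].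

Definition geometric_growth (V : completeNormedModType R[i])
    (A : Omega -> Omega -> {linear V -> V}) :=
  exists2 l, superadditive_length l &
    forall u v, E (u, v) -> opnorm (A u v) <= l u v.

Definition generating_family (V : completeNormedModType R[i])
    (A : Omega -> Omega -> {linear V -> V}) :=
  [/\ forall u v, E (u, v) -> bounded_operator (A u v),
      norm_continuous A,
      additive_family A,
      geometric_growth A
    & forall u v, E (u, v) -> contractive (exp_operator (A u v))].

End Families.

(* Unital C*-algebras. The ring structure is part of the mixin because the
   hierarchy has no join of ring structures with NormedModule, so algType
   cannot be inherited here. 1 != 0 is not required: the zero algebra is
   allowed. *)
HB.mixin Record isCStarAlgebra (R : realType) A
    of CompleteNormedModule R[i] A := {
  cmul : A -> A -> A ;
  cone : A ;
  star : A -> A ;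
  cmulA : associative cmul ;
  cmul1l : left_id cone cmul ;
  cmul1r : right_id cone cmul ;
  cmulDl : left_distributive cmul +%R ;
  cmulDr : right_distributive cmul +%R ;
  cmulZl : forall (c : R[i]) (a b : A), cmul (c *: a) b = c *: cmul a b ;
  cmulZr : forall (c : R[i]) (a b : A), cmul a (c *: b) = c *: cmul a b ;
  starK : involutive star ;
  starD : {morph star : a b / a + b} ;
  starZ : forall (c : R[i]) (a : A), star (c *: a) = conjc c *: star a ;
  starM : forall a b, star (cmul a b) = cmul (star b) (star a) ;
  norm_cmul_le : forall a b : A, `|cmul a b| <= `|a| * `|b| ;
  norm_cmul_star : forall a : A, `|cmul (star a) a| = `|a| ^+ 2
}.

#[short(type="cstarAlgType")]
HB.structure Definition CStarAlgebra (R : realType) :=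
  {A of CompleteNormedModule R[i] A & isCStarAlgebra R A}.

Reserved Notation "a ** b" (at level 40, left associativity).
Notation "a ** b" := (cmul a b) : ring_scope.

Definition commutative_alg (R : realType) (A : cstarAlgType R) :=
  commutative (@cmul R A).

Section CStar.
Context {R : realType}.

Definition positive_elt (A : cstarAlgType R) (a : A) :=
  exists b : A, a = star b ** b.

Definition selfadjoint_map (A : cstarAlgType R) (L : A -> A) :=
  forall a, star a = a -> star (L a) = L a.

Definition dissipation_map (A : cstarAlgType R) (L : A -> A) (a b : A) : A :=
  L (star b ** a) - (star (L b) ** a + star b ** L a).

Definition positive_map (A B : cstarAlgType R) (f : A -> B) :=
  forall a, positive_elt a -> positive_elt (f a).

Definition unital_star_hom (A B : cstarAlgType R) (f : {linear A -> B}) :=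
  [/\ f (cone : A) = cone, {morph f : a b / a ** b}
    & {morph f : a / star a}].

Definition star_automorphism (A : cstarAlgType R) (f : {linear A -> A}) :=
  unital_star_hom f /\ bijective f.

End CStar.

Section Dilations.
Context {R : realType} {Omega : topologicalType} (E : set (Omega * Omega)).

Definition banach_dilation (V W : completeNormedModType R[i])
    (A : Omega -> Omega -> {linear V -> V}) :=
  exists (U : Omega -> Omega -> {linear W -> W})
         (j : {linear W -> V}) (r : {linear V -> W}),
    [/\ divisible_system E U /\ strongly_continuous E U,
        forall u v, E (u, v) ->
          isometric (U u v) /\ (forall y, exists x, U u v x = y),
        contractive j /\ (forall y, exists x, j x = y),
        isometric r /\ (forall x, j (r x) = x)
      & forall u v, E (u, v) ->
          forall x, j (U u v (r x)) = exp_operator (A u v) x].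

Definition cstar_dilation (A B : cstarAlgType R)
    (L : Omega -> Omega -> {linear A -> A}) :=
  exists (U : Omega -> Omega -> {linear B -> B})
         (j : {linear B -> A}) (r : {linear A -> B}),
    [/\ divisible_system E U /\ strongly_continuous E U,
        forall u v, E (u, v) -> star_automorphism (U u v),
        unital_star_hom j /\ (forall y, exists x, j x = y),
        [/\ isometric r, positive_map r, r cone = cone
          & forall a, j (r a) = a]
      & forall u v, E (u, v) ->
          forall a, j (U u v (r a)) = exp_operator (L u v) a].

End Dilations.

(* Main.v *)
Require Import Defs.
From HB Require Import structures.
From mathcomp Require Import all_boot all_order all_algebra complex.
From mathcomp Require Import all_classical all_reals all_analysis.
From mathcomp Require Import ring lra.

Set Implicit Arguments.
Unset Strict Implicit.
Unset Printing Implicit Defensive.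

Import Order.TTheory GRing.Theory Num.Theory.
Import numFieldNormedType.Exports.

Local Open Scope classical_set_scope.
Local Open Scope ring_scope.

(** Any function T from a group G to the contractions of V with T(1) = I dilates to a
    group of isometries: let G translate the bounded functions G -> V, let r a be the orbit
    function g |-> T(g) a, and let j evaluate at 1; then j U(g) r = T(g).  The theorem follows
    from a suitable choice of G and of an extension T of the family e^{A(u,v)} to G.

    G is the group of finite unions of half-open intervals of Omega under symmetric
    difference, and the edge (u, v) stands for [u, v).  For u <= v <= w the sum of [u, v) and
    [v, w) is [u, w), which makes the translations a divisible system.  By additivity, A
    extends to a finitely additive operator measure on G ([mass]), and T(S) = e^{A(S)}.

    Two facts make this work.  First, e^{A(S)} is a contraction although A(S) is only a sum of
    generators: the estimate |x + s A x| <= (1 + C s^2) |x| for s >= 0 ([tangent_contraction])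
    passes to sums, because x + s (A + B) x is the mean of x + 2 s A x and x + 2 s B x, and it
    bounds e^A = lim (1 + A/n)^n by 1.  The same approximation shows |e^X - e^Y| <= |X - Y| for
    two such generators.  Secondly, translating S by [u, v) changes A(S) by a signed sum of
    values of A on disjoint subintervals of [u, v), of norm at most l(u, v) by superadditivity
    ([mass_toggle_le]).  Hence |T(S + [u, v)) a - T(S) a| <= l(u, v) |a| for all S: orbit
    functions are uniformly continuous with respect to l.  The dilation space [buc] consists of
    the bounded functions with this uniform continuity; since l is continuous and vanishes on
    the diagonal, translations are strongly continuous there.

    For (a), a dissipative A satisfies |(1 - s A) x| >= |x|, and the tangent estimate follows
    by inserting (1 + s A) x for x.  For (b), the functions with values in a C*-algebra form a
    C*-algebra, on which translations are automorphisms and j is a homomorphism.  If M is the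
    norm of 1 + s L and |a| <= 1, then D_L(a, a) >= 0 says that (a + s L a)^* (a + s L a) is at
    most (1 + s L)(a^* a) + s^2 (L a)^* (L a), so M^2 <= M + s^2 |L|^2 and M <= 1 + s^2 |L|^2.
    This step and the positivity of r use the order of a C*-algebra, which is built here from
    square roots alone: a has the form b^* b if and only if it is self-adjoint and
    |t - a| <= t for some t >= 0 ([positive_eltP]).  That norm condition is visibly preserved
    by sums and by unital isometries. *)

(** * Real-valued norms and convergence *)

Section NormR.
Context {R : realType} {V : normedModType R[i]}.
Implicit Types (x y : V) (c : R[i]) (s : R).

Lemma normRE x : `|x| = (normR x)%:C%C.
Proof. by rewrite /normR RRe_real // ger0_real. Qed.

Lemma normR_ge0 x : 0 <= normR x.
Proof. by rewrite -ler0c -normRE. Qed.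

Lemma normR0 : normR (0 : V) = 0.
Proof. by rewrite /normR normr0. Qed.

Lemma normR0_eq0 x : normR x = 0 -> x = 0.
Proof. by move=> h; apply/normr0_eq0; rewrite normRE h. Qed.

Lemma ler_normRD x y : normR (x + y) <= normR x + normR y.
Proof. by rewrite -lecR rmorphD /= -!normRE ler_normD. Qed.

Lemma normRN x : normR (- x) = normR x.
Proof. by rewrite /normR normrN. Qed.

Lemma normRB x y : normR (x - y) = normR (y - x).
Proof. by rewrite -normRN opprB. Qed.

Lemma ler_normRB x y : normR (x - y) <= normR x + normR y.
Proof. by rewrite -(normRN y) ler_normRD. Qed.

Lemma ler_normRBD x y z : normR (x - z) <= normR (x - y) + normR (y - z).
Proof. by rewrite -(subrKA y) ler_normRD. Qed.

Lemma normRZ c x : normR (c *: x) = complex.Re `|c| * normR x.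
Proof.
apply: (@complexI R); rewrite -normRE normrZ normRE rmorphM /=.
by rewrite RRe_real // ger0_real.
Qed.

Lemma normRZr s x : normR (s%:C%C *: x) = `|s| * normR x.
Proof. by rewrite normRZ normc_def /= expr0n /= addr0 sqrtr_sqr. Qed.

Lemma normRZp s x : 0 <= s -> normR (s%:C%C *: x) = s * normR x.
Proof. by move=> s0; rewrite normRZr ger0_norm. Qed.

Lemma normR_le0 x : normR x <= 0 -> x = 0.
Proof.
by move=> h; apply: normR0_eq0; apply/eqP; rewrite eq_le h normR_ge0.
Qed.

End NormR.

Lemma gt0_real_complex (R : realType) (e : R[i]) : 0 < e ->
  exists2 r : R, 0 < r & e = r%:C%C.
Proof.
move=> e0; have eR : e \is Num.real by rewrite gtr0_real.
exists (complex.Re e); last by rewrite RRe_real.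
by rewrite -ltcR RRe_real.
Qed.

Section Convergence.
Context {R : realType} {V : normedModType R[i]}.

Lemma cvg_normRP {T : Type} (F : set_system T) {FF : Filter F} (f : T -> V) (l : V) :
  f @ F --> l <-> forall e : R, 0 < e -> \forall t \near F, normR (l - f t) <= e.
Proof.
split=> [/cvgrPdist_le h e e0|h].
  have /h : 0 < e%:C%C :> R[i] by rewrite ltcR.
  by apply: filterS => t; rewrite normRE lecR.
apply/cvgrPdist_le => e /gt0_real_complex[r r0 ->].
by move: (h r r0); apply: filterS => t; rewrite normRE lecR.
Qed.

Lemma cvgn_normRP (u : nat -> V) (l : V) :
  u @ \oo --> l <->
  forall e : R, 0 < e -> exists N, forall n, (N <= n)%N -> normR (l - u n) <= e.
Proof.
split=> [/cvg_normRP h e /h[N _ hN]|h].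
  by exists N => n Nn; exact: hN.
apply/cvg_normRP => e /h[N hN]; exists N => // n /= Nn; exact: hN.
Qed.

Lemma limit_unique (u : nat -> V) (l l' : V) : u @ \oo --> l -> u @ \oo --> l' -> l = l'.
Proof. by move=> h h'; apply: (cvg_unique _ h h'); exact: norm_hausdorff. Qed.

Lemma cvgn_normR (u : nat -> V) (l : V) : u @ \oo --> l -> (fun n => normR (u n)) @ \oo --> normR l.
Proof.
move=> /cvgn_normRP h; apply/cvgrPdist_le => e /h[N hN].
exists N => // n /= Nn; apply: le_trans (hN n Nn); rewrite ler_distl.
have := ler_normRD (l - u n) (u n); rewrite subrK => h1.
have := ler_normRD (u n - l) l; rewrite subrK (normRB (u n)) => h2.
by apply/andP; split; lra.
Qed.

Lemma normR_lim_le (u : nat -> V) (b : nat -> R) (l : V) (m : R) :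
  u @ \oo --> l -> b @ \oo --> m -> (forall n, normR (u n) <= b n) -> normR l <= m.
Proof.
move=> /cvgn_normR ul bm ub.
rewrite -(cvg_lim (@Rhausdorff R) ul) -(cvg_lim (@Rhausdorff R) bm).
apply: ler_lim; [by apply/cvg_ex; exists (normR l)|by apply/cvg_ex; exists m|].
by near=> n; apply: ub.
Unshelve. all: by end_near. Qed.

End Convergence.

Section BoundedOperators.
Context {R : realType} {V : normedModType R[i]}.

Lemma bounded_linear_cvg {W : normedModType R[i]} (f : V -> W) (K : R) (u : nat -> V) (l : V) :
  (forall x y, f (x - y) = f x - f y) ->
  (forall x, normR (f x) <= K * normR x) ->
  u @ \oo --> l -> (f \o u) @ \oo --> f l.
Proof.
move=> fB fK /cvgn_normRP h.
have K1 : 0 < `|K| + 1 by rewrite ltr_wpDl.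
apply/cvg_normRP => e e0.
have [|N hN] := h (e / (`|K| + 1)); first by rewrite divr_gt0.
exists N => // n /= Nn; rewrite -fB; apply: le_trans (fK _) _.
apply: (@le_trans _ _ ((`|K| + 1) * normR (l - u n))).
  apply: ler_wpM2r; first exact: normR_ge0.
  by apply: le_trans (ler_norm _) _; rewrite lerDl.
by rewrite mulrC -ler_pdivlMr //; exact: hN.
Qed.

Lemma bounded_operator_pos {W : normedModType R[i]} (f : V -> W) :
  bounded_operator f ->
  exists2 K : R, 0 <= K & forall x, normR (f x) <= K * normR x.
Proof.
move=> [K hK]; exists `|K| => // x; apply: le_trans (hK x) _.
by apply: ler_wpM2r; rewrite ?normR_ge0 ?ler_norm.
Qed.

End BoundedOperators.

(** The increments need only be dominated by those of a convergent real sequence, so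
    that the scalar case of an iteration settles the operator or algebra case. *)
Lemma cvg_dominated_increments (R : realType) (V : completeNormedModType R[i])
    (u : nat -> V) (s : nat -> R) :
  (forall n, normR (u n.+1 - u n) <= s n.+1 - s n) -> cvgn s -> cvgn u.
Proof.
move=> us cs.
have uss n k : normR (u (n + k)%N - u n) <= s (n + k)%N - s n.
  elim: k => [|k IH]; first by rewrite addn0 !subrr normR0.
  rewrite addnS; apply: le_trans (ler_normRBD _ (u (n + k)%N) _) _.
  by have := us (n + k)%N; lra.
apply: cauchy_cvg; apply/cauchy_ballP => e /gt0_real_complex[r r0 ->].
have r20 : 0 < r / 2 by rewrite divr_gt0.
have /cvgrPdist_lt /(_ _ r20) [N _ hN] := cs.
have hN' n : (N <= n)%N -> normR (u n - u N) < r.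
  move=> Nn; rewrite -(subnKC Nn); apply: le_lt_trans (uss _ _) _.
  rewrite subnKC //.
  have := hN n Nn; have := hN N (leqnn N); rewrite /= !ltr_norml.
  by move=> /andP[? ?] /andP[? ?]; lra.
exists ([set u n | n in [set n | (N <= n)%N]], [set u n | n in [set n | (N <= n)%N]]).
  by split; exists N => // n /= Nn; exists n.
move=> [_ _] [/= [n Nn <-] [m Nm <-]].
rewrite -ball_normE /ball_ /= normRE ltcR.
wlog nm : n m Nn Nm / (n <= m)%N.
  move=> H; case: (leqP n m) => [|/ltnW] nm; first exact: H.
  by rewrite normRB; exact: H.
rewrite normRB -(subnKC nm); apply: le_lt_trans (uss _ _) _.
rewrite subnKC //; have := hN n Nn; have := hN m Nm; rewrite /= !ltr_norml.
by move=> /andP[? ?] /andP[? ?]; lra.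
Qed.

(** * Exponentials as limits of Euler products *)

Section RealEstimates.
Context {R : realType}.
Implicit Types (K : R) (n k : nat).

(** With h = K / (n + 1) this is a power of exp(h - h^2) <= 1 + h, which comes from
    exp(h^2 - h) (1 + h) >= (1 + h^2 - h) (1 + h) = 1 + h^3 >= 1. *)
Lemma expR_pow_bound K n : 0 <= K ->
  expR (K - K ^+ 2 / n.+1%:R) <= (1 + K / n.+1%:R) ^+ n.+1.
Proof.
move=> K0; set h := K / n.+1%:R.
have h0 : 0 <= h by rewrite divr_ge0.
have -> : K - K ^+ 2 / n.+1%:R = n.+1%:R * (h - h ^+ 2).
  have N0 : n.+1%:R != 0 :> R by rewrite pnatr_eq0.
  by rewrite /h; move: (n.+1%:R : R) N0 => N N0; field.
rewrite expRM_natl lerXn2r ?nnegrE ?expR_ge0 ?addr_ge0 //.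
have h1 := expR_ge1Dx (h ^+ 2 - h).
have -> : h - h ^+ 2 = - (h ^+ 2 - h) by ring.
rewrite expRN -[leLHS]mul1r ler_pdivrMr ?expR_gt0 //.
apply: (@le_trans _ _ ((1 + h) * (1 + (h ^+ 2 - h)))); last first.
  by apply: ler_wpM2l => //; rewrite addr_ge0.
have -> : (1 + h) * (1 + (h ^+ 2 - h)) = 1 + h ^+ 3 by ring.
by rewrite lerDl exprn_ge0.
Qed.

Lemma pow_expR_bound (C : R) n : 0 <= C ->
  (1 + C * (n.+1%:R^-1) ^+ 2) ^+ n.+1 <= expR (C * n.+1%:R^-1).
Proof.
move=> C0; have -> : C * n.+1%:R^-1 = n.+1%:R * (C * n.+1%:R^-1 ^+ 2).
  have N0 : n.+1%:R != 0 :> R by rewrite pnatr_eq0.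
  by move: (n.+1%:R : R) N0 => N N0; field.
rewrite expRM_natl lerXn2r ?nnegrE ?expR_ge0 ?addr_ge0 ?mulr_ge0 ?exprn_ge0 //.
exact: expR_ge1Dx.
Qed.

Lemma cvg_harmonicM (C : R) : (fun n => C * n.+1%:R^-1) @ \oo --> 0.
Proof.
rewrite -(mulr0 C); apply: cvgM; [exact: cvg_cst|exact: cvg_harmonic].
Qed.

Lemma cvg_expR_harmonic (a C : R) :
  (fun n => expR (a + C * n.+1%:R^-1)) @ \oo --> expR a.
Proof.
have expRa := @continuous_expR R (a + 0).
rewrite -[X in expR X]addr0.
apply: (cvg_comp (fun n => a + C * n.+1%:R^-1) expR _ expRa).
by apply: cvgD; [exact: cvg_cst|exact: cvg_harmonicM].
Qed.

Lemma cvg_expR_harmonicM (C a : R) :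
  (fun n => expR (C * n.+1%:R^-1) * a) @ \oo --> a.
Proof.
have h := cvgM (@cvg_expR_harmonic 0 C) (@cvg_cst _ a _ \oo _).
rewrite expR0 mul1r in h.
suff -> : (fun n : nat => expR (C * n.+1%:R^-1) * a) =
          (fun n : nat => expR (0 + C * n.+1%:R^-1) * a) by exact: h.
by apply: funext => n; rewrite add0r.
Qed.

Lemma bin_pow_le_inv_fact m k : ('C(m.+1, k)%:R / m.+1%:R ^+ k <= k`!%:R^-1 :> R).
Proof.
rewrite ler_pdivrMr ?exprn_gt0 // ler_pdivlMl ?ltr0n ?fact_gt0 //.
rewrite -natrX -natrM ler_nat mulnC bin_ffact.
suff le_pow n : (n <= m.+1)%N -> (n ^_ k <= m.+1 ^ k)%N by exact: le_pow.
elim: k n => [|k IH] n nm //.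
rewrite ffactnS expnS leq_mul //; apply: IH; exact: leq_trans (leq_pred _) nm.
Qed.

Lemma series_exp_coeff_le K n : 0 <= K -> series (exp_coeff K) n <= expR K.
Proof.
move=> K0; apply: nondecreasing_cvgn_le; last exact: is_cvg_series_exp_coeff.
by apply: nondecreasing_series => k _ _; exact: exp_coeff_ge0.
Qed.

End RealEstimates.

Section Exponential.
Context {R : realType} {V : completeNormedModType R[i]}.
Implicit Types (X Y : {linear V -> V}) (x : V) (K : R).

Lemma iter_normR_le X K : 0 <= K -> (forall x, normR (X x) <= K * normR x) ->
  forall k x, normR (iter k X x) <= K ^+ k * normR x.
Proof.
move=> K0 hK; elim=> [|k IH] x; first by rewrite expr0 mul1r.
rewrite iterS exprS -mulrA; apply: le_trans (hK _) _.
exact: ler_wpM2l.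
Qed.

Lemma exp_operator_cvg X : bounded_operator X -> forall x,
  series (fun n => (n`!%:R : R[i])^-1 *: iter n X x) @ \oo --> exp_operator X x.
Proof.
move=> /bounded_operator_pos[K K0 hK] x.
suff : cvgn (series (fun n => (n`!%:R : R[i])^-1 *: iter n X x)) by [].
apply: (@cvg_dominated_increments _ _ _ (fun n => series (exp_coeff K) n * normR x)).
  move=> n; rewrite -mulrBl !seriesSB /exp_coeff /=.
  have -> : (n`!%:R : R[i])^-1 = ((n`!%:R : R)^-1)%:C%C.
    by rewrite fmorphV rmorph_nat.
  rewrite normRZp ?invr_ge0 ?ler0n // [K ^+ n / _]mulrC -mulrA.
  by apply: ler_wpM2l; rewrite ?invr_ge0 ?ler0n //; exact: iter_normR_le.
by apply: is_cvgM; [exact: is_cvg_series_exp_coeff|exact: is_cvg_cst].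
Qed.

Definition euler_step X (h : R) x := x + h%:C%C *: X x.

Lemma iter_euler_stepE X h m x :
  iter m (euler_step X h) x =
  \sum_(k < m.+1) ('C(m, k)%:R * h ^+ k)%:C%C *: iter k X x.
Proof.
elim: m => [|m IH]; first by rewrite big_ord1 bin0 expr0 mulr1 scale1r.
rewrite iterS IH /euler_step linear_sum scaler_sumr.
rewrite [in RHS]big_ord_recl /= bin0 expr0 mulr1 scale1r.
under [in RHS]eq_bigr => k _ do
  rewrite /bump /= add1n binS natrD mulrDl rmorphD /= scalerDl.
rewrite big_split /= addrA; congr (_ + _).
  rewrite big_ord_recl /= bin0 expr0 mulr1 scale1r; congr (_ + _).
  rewrite [RHS]big_ord_recr /= bin_small // mul0r scale0r addr0.
  by apply: eq_bigr => k _; rewrite /bump /= add1n.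
apply: eq_bigr => k _; rewrite linearZ /= scalerA -rmorphM /= exprS.
by rewrite mulrCA.
Qed.

(** Compare coefficients: the binomial coefficient over n^k never exceeds 1 / k!, so in
    the difference of the two polynomials in X every coefficient is nonnegative and the norm is
    at most the same difference evaluated at the scalar K >= |X|, where it tends to 0. *)
Lemma euler_cvg_exp X : bounded_operator X -> forall x,
  (fun n => iter n.+1 (euler_step X n.+1%:R^-1) x) @ \oo --> exp_operator X x.
Proof.
move=> bX x; have [K K0 hK] := bounded_operator_pos bX.
have /cvg_normRP expX := @exp_operator_cvg X bX x.
have small : (fun n : nat => (expR K - expR (K + - K ^+ 2 * n.+1%:R^-1)) * normR x)
    @ \oo --> (0 : R).
  rewrite -(mul0r (normR x)) -(subrr (expR K)); apply: cvgM; last exact: cvg_cst.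
  by apply: cvgB; [exact: cvg_cst|exact: cvg_expR_harmonic].
apply/cvg_normRP => e e0.
have e20 : 0 < e / 2 by rewrite divr_gt0.
have [N _ hN] := expX _ e20.
have /cvgrPdist_le /(_ _ e20)[M _ hM] := small.
exists (maxn N M) => // n /=; rewrite geq_max => /andP[Nn Mn].
apply: le_trans (ler_normRBD _ (series (fun n => (n`!%:R : R[i])^-1 *: iter n X x) n.+2) _) _.
have := hN n.+2 (leq_trans Nn (leqW (leqnSn n))); move: (hM n Mn) => /=.
rewrite sub0r normrN; set B := (_ - expR _) * _ => hB h.
suff : normR (series (fun n => (n`!%:R : R[i])^-1 *: iter n X x) n.+2 -
   iter n.+1 (euler_step X n.+1%:R^-1) x) <= B.
  by move: hB; rewrite ler_norml => /andP[? ?] ?; lra.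
rewrite iter_euler_stepE seriesEord /= -sumrB.
under eq_bigr => k _.
  have -> : (k`!%:R : R[i])^-1 = ((k`!%:R : R)^-1)%:C%C.
    by rewrite fmorphV rmorph_nat.
  rewrite -scalerBl -rmorphB /= exprVn; over.
apply: (@le_trans _ _ (\sum_(k < n.+2)
    (k`!%:R^-1 - 'C(n.+1, k)%:R / n.+1%:R ^+ k) * (K ^+ k * normR x))).
  elim/big_ind2 : _ => [|y a z b ya zb|k _]; first by rewrite normR0.
    by apply: le_trans (ler_normRD _ _) _; exact: lerD.
  have c0 : 0 <= k`!%:R^-1 - 'C(n.+1, k)%:R / n.+1%:R ^+ k :> R.
    by rewrite subr_ge0 bin_pow_le_inv_fact.
  by rewrite normRZp //; apply: ler_wpM2l => //; exact: iter_normR_le.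
under eq_bigr => k _ do rewrite mulrA.
rewrite -mulr_suml; apply: ler_wpM2r; first exact: normR_ge0.
under eq_bigr => k _ do rewrite mulrBl.
rewrite sumrB; apply: lerB.
  have := series_exp_coeff_le n.+2 K0; rewrite seriesEord /exp_coeff /=.
  by under eq_bigr => k _ do rewrite mulrC.
rewrite mulNr; apply: le_trans (expR_pow_bound n K0) _.
rewrite exprDn /=; apply: ler_sum => k _ /=.
by rewrite exprMn exprVn expr1n mul1r -mulr_natr mulrC [K ^+ k * _]mulrC mulrA.
Qed.
End Exponential.

(** * Generators of contractions *)

Section OperatorNorm.
Context {R : realType} {V W : normedModType R[i]}.

Lemma opnorm_ge (f : {linear V -> W}) : bounded_operator f ->
  forall x, normR x <= 1 -> normR (f x) <= opnorm f.
Proof.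
move=> bf x x1; have [K K0 hK] := bounded_operator_pos bf.
apply: sup_upper_bound; last by exists x.
split; first by exists (normR (f x)); exists x.
exists K => _ [z /= z1 <-]; apply: le_trans (hK z) _.
by rewrite -[leRHS]mulr1; apply: ler_wpM2l.
Qed.

Lemma opnorm_le (f : {linear V -> W}) (B : R) :
  (forall x, normR x <= 1 -> normR (f x) <= B) -> opnorm f <= B.
Proof.
move=> hB; apply: ge_sup; last by move=> _ [x /= x1 <-]; exact: hB.
by exists (normR (f 0)); exists 0 => //=; rewrite normR0.
Qed.

Lemma opnorm_bound (f : {linear V -> W}) : bounded_operator f ->
  forall x, normR (f x) <= opnorm f * normR x.
Proof.
move=> bf x; have [x0|x0] := eqVneq (normR x) 0.
  by rewrite (normR0_eq0 x0) linear0 !normR0 mulr0.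
have xgt0 : 0 < normR x by rewrite lt_def x0 normR_ge0.
rewrite -ler_pdivrMr // mulrC -normRZp ?invr_ge0 ?normR_ge0 // -linearZ.
by apply: opnorm_ge => //; rewrite normRZp ?invr_ge0 ?normR_ge0 // mulVf.
Qed.

End OperatorNorm.

Section TangentContraction.
Context {R : realType} {V : completeNormedModType R[i]}.
Implicit Types (X Y : {linear V -> V}) (x : V) (C s : R).

(** Equivalent to dissipativity for bounded operators, but phrased by norms only: it
    refers to no duality section, and its stability under sums is a convexity argument. *)
Definition tangent_contraction (f : V -> V) := exists2 C : R, 0 <= C &
  forall (s : R) (x : V), 0 <= s ->
    normR (x + s%:C%C *: f x) <= (1 + C * s ^+ 2) * normR x.

Lemma tangent_contraction0 : tangent_contraction (fun=> 0).
Proof. by exists 0 => // s x _; rewrite scaler0 addr0 mul0r addr0 mul1r. Qed.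

(** x + s (f x + g x) is the mean of x + 2 s f x and x + 2 s g x. *)
Lemma tangent_contractionD (f g : V -> V) :
  tangent_contraction f -> tangent_contraction g ->
  tangent_contraction (fun x => f x + g x).
Proof.
move=> [C C0 hC] [D D0 hD]; exists (2 * (C + D)).
  by rewrite mulr_ge0 // addr_ge0.
move=> s x s0; have h0 : 0 <= 2^-1 :> R by [].
have s20 : 0 <= 2 * s by rewrite mulr_ge0.
have -> : x + s%:C%C *: (f x + g x) = (2^-1 : R)%:C%C *: (x + (2 * s)%:C%C *: f x) +
    (2^-1 : R)%:C%C *: (x + (2 * s)%:C%C *: g x).
  have half : (2^-1 : R)%:C%C * (2 * s)%:C%C = s%:C%C.
    by rewrite -rmorphM /= mulrA mulVf // mul1r.
  rewrite !scalerDr !scalerA half addrACA -scalerDl -rmorphD /=.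
  have -> : (2^-1 + 2^-1 : R) = 1 by field.
  by rewrite scale1r.
apply: le_trans (ler_normRD _ _) _; rewrite !normRZp //.
have := hC (2 * s) x s20; have := hD (2 * s) x s20.
set a := normR _; set b := normR (_ + _ *: f x) => ha hb.
have -> : (1 + 2 * (C + D) * s ^+ 2) * normR x =
  2^-1 * ((1 + C * (2 * s) ^+ 2) * normR x) + 2^-1 * ((1 + D * (2 * s) ^+ 2) * normR x).
  by field.
by apply: lerD; apply: ler_wpM2l.
Qed.

Lemma euler_step_normR_le X C s : 0 <= C -> 0 <= s ->
  (forall x, normR (x + s%:C%C *: X x) <= (1 + C * s ^+ 2) * normR x) ->
  forall k x, normR (iter k (euler_step X s) x) <= (1 + C * s ^+ 2) ^+ k * normR x.
Proof.
move=> C0 s0 hX; elim=> [|k IH] x; first by rewrite expr0 mul1r.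
rewrite iterS exprS -mulrA; apply: le_trans (hX _) _.
by apply: ler_wpM2l => //; rewrite addr_ge0 ?mulr_ge0 ?exprn_ge0.
Qed.

(** (1 + C / n^2)^n tends to 1. *)
Lemma exp_operator_contractive X : bounded_operator X -> tangent_contraction X ->
  contractive (exp_operator X).
Proof.
move=> bX [C C0 hC] x.
apply: (@normR_lim_le _ _ _ (fun n => expR (C * n.+1%:R^-1) * normR x)
  _ _ (@euler_cvg_exp _ _ X bX x)).
  exact: cvg_expR_harmonicM.
move=> n; have n0 : 0 <= n.+1%:R^-1 :> R by rewrite invr_ge0.
apply: le_trans (euler_step_normR_le C0 n0 (fun x => hC _ x n0) _ _) _.
apply: ler_wpM2r; [exact: normR_ge0|exact: pow_expR_bound].
Qed.

(** Telescoping the n-th powers of 1 + X/n and 1 + Y/n costs n terms, each with a factor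
    |X - Y| / n between products of norm at most (1 + C / n^2)^n. *)
Lemma exp_operator_lipschitz X Y (D : R) :
  bounded_operator X -> tangent_contraction X ->
  bounded_operator Y -> tangent_contraction Y ->
  0 <= D -> (forall x, normR (X x - Y x) <= D * normR x) ->
  forall x, normR (exp_operator X x - exp_operator Y x) <= D * normR x.
Proof.
move=> bX [B B0 hB] bY [C' C'0 hC'] D0 hD x.
pose C := B + C'; have C0 : 0 <= C by rewrite addr_ge0.
have hX s y : 0 <= s -> normR (y + s%:C%C *: X y) <= (1 + C * s ^+ 2) * normR y.
  move=> s0; apply: le_trans (hB s y s0) _; apply: ler_wpM2r; rewrite ?normR_ge0 //.
  by rewrite lerD2l; apply: ler_wpM2r; rewrite ?exprn_ge0 // lerDl.
have hY s y : 0 <= s -> normR (y + s%:C%C *: Y y) <= (1 + C * s ^+ 2) * normR y.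
  move=> s0; apply: le_trans (hC' s y s0) _; apply: ler_wpM2r; rewrite ?normR_ge0 //.
  by rewrite lerD2l; apply: ler_wpM2r; rewrite ?exprn_ge0 // lerDr.
(* |X^k - Y^k| <= k |X - Y| q^k for the k-th Euler iterates, q bounding both steps. *)
have diff s k : 0 <= s ->
    normR (iter k (euler_step X s) x - iter k (euler_step Y s) x) <=
    k%:R * (s * D) * (1 + C * s ^+ 2) ^+ k * normR x.
  move=> s0; set q := 1 + C * s ^+ 2.
  have q1 : 1 <= q by rewrite lerDl mulr_ge0 // exprn_ge0.
  have q0 : 0 <= q by exact: le_trans q1.
  elim: k => [|k IH]; first by rewrite subrr normR0 !mul0r.
  rewrite !iterS; set a := iter k _ _; set b := iter k _ _.
  have -> : euler_step X s a - euler_step Y s b =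
      ((a - b) + s%:C%C *: X (a - b)) + s%:C%C *: (X b - Y b).
    by rewrite /euler_step linearB -[RHS]addrA -scalerDr subrKA scalerBr opprD addrACA.
  apply: le_trans (ler_normRD _ _) _; rewrite normRZp //.
  have nb : normR b <= q ^+ k * normR x.
    by apply: euler_step_normR_le => // y; exact: hY.
  have h1 : normR (a - b + s%:C%C *: X (a - b)) <=
      q * (k%:R * (s * D) * q ^+ k * normR x).
    by apply: le_trans (hX _ _ s0) _; apply: ler_wpM2l.
  have h2 : s * normR (X b - Y b) <= s * (D * (q ^+ k * normR x)).
    by apply: ler_wpM2l => //; apply: le_trans (hD _) _; exact: ler_wpM2l.
  apply: le_trans (lerD h1 h2) _.
  have h3 : s * (D * (q ^+ k * normR x)) <= q * (s * (D * (q ^+ k * normR x))).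
    by rewrite ler_peMl // !mulr_ge0 ?exprn_ge0 ?normR_ge0.
  apply: le_trans (lerD (lexx _) h3) _.
  by rewrite -natr1 exprS le_eqVlt; apply/orP; left; apply/eqP; ring.
apply: (@normR_lim_le _ _ _ (fun n => expR (C * n.+1%:R^-1) * (D * normR x)) _ _
  (cvgB (@euler_cvg_exp _ _ X bX x) (@euler_cvg_exp _ _ Y bY x))).
  exact: cvg_expR_harmonicM.
move=> n; have n0 : 0 <= n.+1%:R^-1 :> R by rewrite invr_ge0.
apply: le_trans (diff _ _ n0) _.
rewrite mulrA divff ?pnatr_eq0 // mul1r [D * _]mulrC -mulrA.
by apply: ler_wpM2r; [rewrite mulr_ge0 ?normR_ge0|exact: pow_expR_bound].
Qed.

Lemma exp_operator_fixed X x : bounded_operator X -> X x = 0 -> exp_operator X x = x.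
Proof.
move=> bX X0; apply: limit_unique (@euler_cvg_exp _ _ X bX x) _.
have fixed h k : iter k (euler_step X h) x = x.
  by elim: k => // k; rewrite iterS => ->; rewrite /euler_step X0 scaler0 addr0.
suff -> : (fun n => iter n.+1 (euler_step X n.+1%:R^-1) x) = fun=> x by exact: cvg_cst.
by apply: funext => n; exact: fixed.
Qed.

Lemma exp_operator_is_linear X : bounded_operator X -> linear (exp_operator X).
Proof.
move=> bX c x y; apply: limit_unique (@euler_cvg_exp _ _ X bX _) _.
have step_linear h k : iter k (euler_step X h) (c *: x + y) =
    c *: iter k (euler_step X h) x + iter k (euler_step X h) y.
  elim: k => // k; rewrite !iterS => ->; rewrite /euler_step linearP !scalerDr.
  by rewrite !scalerA [c * _]mulrC addrACA.
have h := cvgD (cvgZl_tmp (k := c) (@euler_cvg_exp _ _ X bX x)) (@euler_cvg_exp _ _ X bX y).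
suff -> : (fun n => iter n.+1 (euler_step X n.+1%:R^-1) (c *: x + y)) =
    (fun n => c *: iter n.+1 (euler_step X n.+1%:R^-1) x +
      iter n.+1 (euler_step X n.+1%:R^-1) y) by exact: h.
by apply: funext => n; exact: step_linear.
Qed.

(** Pairing x - s X x with J x gives |x| <= |x - s X x|; for x + s X x in place of x the
    right-hand side is x - s^2 X (X x). *)
Lemma dissipative_tangent_contraction X :
  bounded_operator X -> dissipative X -> tangent_contraction X.
Proof.
move=> bX [J hJ dJ]; have [K K0 hK] := bounded_operator_pos bX.
have resolvent s x : 0 <= s -> normR x <= normR (x - s%:C%C *: X x).
  move=> s0; have [bJ nJ Jx] := hJ x.
  have [x0|x0] := eqVneq (normR x) 0; first by rewrite x0 normR_ge0.
  have xgt0 : 0 < normR x by rewrite lt_def x0 normR_ge0.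
  rewrite -(ler_pM2l xgt0) -{3}nJ; apply: le_trans (opnorm_bound bJ _).
  have := normc_ge_Re (J x (x - s%:C%C *: X x)).
  rewrite -/(normR (J x _)) linearB linearZ /= Jx normRE.
  set z := J x (X x); rewrite -rmorphXn /= => h.
  have {h} h : `|normR x ^+ 2 - s * complex.Re z| <=
      normR ((normR x ^+ 2)%:C%C - s%:C%C * z : R[i]^o).
    rewrite -lecR -normRE; apply: le_trans h; rewrite lecR.
    by case: z => a b /=; rewrite mul0r subr0.
  apply: le_trans h; rewrite -expr2; apply: le_trans (ler_norm _).
  by rewrite lerDl oppr_ge0 mulr_ge0_le0 //; exact: dJ.
exists (K ^+ 2); first exact: exprn_ge0.
move=> s x s0; apply: le_trans (resolvent s _ s0) _.
have -> : x + s%:C%C *: X x - s%:C%C *: X (x + s%:C%C *: X x) =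
    x - (s ^+ 2)%:C%C *: X (X x).
  have XD : X (x + s%:C%C *: X x) = X x + s%:C%C *: X (X x) by rewrite linearD linearZ.
  by rewrite XD scalerDr scalerA -rmorphM /= opprD addrA addrK expr2.
apply: le_trans (ler_normRB _ _) _; rewrite mulrDl mul1r lerD2l.
have -> : K ^+ 2 * s ^+ 2 * normR x = s ^+ 2 * (K * (K * normR x)) by ring.
rewrite normRZp ?exprn_ge0 //; apply: ler_wpM2l; first exact: exprn_ge0.
by apply: le_trans (hK _) _; exact: ler_wpM2l.
Qed.

End TangentContraction.

(** * Finite unions of intervals and the operator measure *)

Section ElementarySets.
Context {d : Order.disp_t} {Omega : orderType d}.
Implicit Types (u v t x y z : Omega) (s p : seq Omega) (S : Omega -> bool).

Definition itv_indicator u v : Omega -> bool := fun t => (u <= t)%O && (t < v)%O.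

(** Translation by [u, v) in the group of subsets of Omega. *)
Definition toggle u v S : Omega -> bool := fun t => S t (+) itv_indicator u v t.

Lemma toggleK u v : involutive (toggle u v).
Proof. by move=> S; apply: funext => t; rewrite /toggle -addbA addbb addbF. Qed.

Lemma toggleC u v x y S : toggle u v (toggle x y S) = toggle x y (toggle u v S).
Proof. by apply: funext => t; rewrite /toggle -!addbA [X in _ (+) X]addbC. Qed.

Lemma toggle_refl u S : toggle u u S = S.
Proof.
apply: funext => t; rewrite /toggle /itv_indicator.
by case: leP => //=; rewrite addbF.
Qed.

Lemma toggle_trans u v w S : (u <= v)%O -> (v <= w)%O ->
  toggle v w (toggle u v S) = toggle u w S.
Proof.
move=> uv vw; apply: funext => t; rewrite /toggle /itv_indicator -addbA; congr (_ (+) _).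
case: (leP v t) => vt /=.
  by rewrite (le_trans uv vt) andbF.
by rewrite (lt_le_trans vt vw) addbF.
Qed.

(** S is a union of intervals [y, z) with endpoints in s.  The condition depends only on
    the members of s, which makes refinement of s trivial. *)
Definition adapted s S := [/\
  forall t t', (t <= t')%O -> (forall z, z \in s -> ~~ (t < z <= t')%O) -> S t = S t',
  forall t, (forall z, z \in s -> (t < z)%O) -> S t = false
  & forall t, (forall z, z \in s -> (z <= t)%O) -> S t = false].

Definition elementary S := exists2 s, sorted <=%O s & adapted s S.

Lemma adapted_subset s s' S : {subset s <= s'} -> adapted s S -> adapted s' S.
Proof.
move=> ss' [h1 h2 h3]; split.
- by move=> t t' tt' h; apply: h1 => // z /ss'; exact: h.
- by move=> t h; apply: h2 => z /ss'; exact: h.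
- by move=> t h; apply: h3 => z /ss'; exact: h.
Qed.

Lemma adapted_toggle s S u v : u \in s -> v \in s -> adapted s S ->
  adapted s (toggle u v S).
Proof.
move=> us vs [h1 h2 h3]; rewrite /toggle /itv_indicator; split.
- move=> t t' tt' h; rewrite (h1 t t' tt' h); congr (_ (+) _).
  move: (h u us) (h v vs).
  have [ut|tu] := leP u t; have [vt|tv] := leP v t => /=.
  + by move=> _ _; rewrite [(t' < v)%O]ltNge (le_trans vt tt') andbF.
  + by rewrite (le_trans ut tt') -ltNge => _ ->.
  + by move=> _ _; rewrite [(t' < v)%O]ltNge (le_trans vt tt') andbF.
  + by rewrite -ltNge => ut' _; rewrite leNgt ut'.
- by move=> t h; rewrite h2 // leNgt h.
- by move=> t h; rewrite h3 // ltNge (h v vs) andbF.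
Qed.

Definition insert z s := merge <=%O [:: z] s.

Lemma sorted_insert z s : sorted <=%O s -> sorted <=%O (insert z s).
Proof. by move=> hs; apply: merge_sorted => //; exact: le_total. Qed.

Lemma perm_insert z s : perm_eq (insert z s) (z :: s).
Proof. by rewrite perm_merge. Qed.

Lemma mem_insert z s x : (x \in insert z s) = (x \in z :: s).
Proof. exact: perm_mem (perm_insert z s) x. Qed.

Lemma elementary_toggle u v S : elementary S -> elementary (toggle u v S).
Proof.
move=> [s hs aS]; exists (insert u (insert v s)); first exact/sorted_insert/sorted_insert.
apply: adapted_toggle.
- by rewrite mem_insert mem_head.
- by rewrite mem_insert in_cons mem_insert mem_head orbT.
- apply: adapted_subset aS => z zs.
  by rewrite mem_insert in_cons mem_insert in_cons zs !orbT.
Qed.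

Lemma adapted_set0 s : adapted s (fun=> false).
Proof. by []. Qed.

End ElementarySets.

Section Mass.
Context {R : realType} {d : Order.disp_t} {Omega : orderType d}.
Context {V : normedModType R[i]} (A : Omega -> Omega -> {linear V -> V}).
Hypothesis A_additive : forall u v w, (u <= v)%O -> (v <= w)%O ->
  forall a, A u w a = A u v a + A v w a.
Implicit Types (u v t x y z : Omega) (s p : seq Omega) (S : Omega -> bool) (a : V).

Lemma additive_refl u a : A u u a = 0.
Proof.
by apply: (@addrI _ (A u u a)); rewrite addr0 -A_additive.
Qed.

Definition sum_linear (f g : {linear V -> V}) : {linear V -> V} := f \+ g.
Definition zero_linear : {linear V -> V} := \0.

(** The Riemann sum of the indicator S against A along x :: p. *)
Fixpoint path_mass S x p : {linear V -> V} :=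
  if p is y :: p' then
    sum_linear (if S x then A x y else zero_linear) (path_mass S y p')
  else zero_linear.

Lemma path_mass_cons S x y p a :
  path_mass S x (y :: p) a = (if S x then A x y a else 0) + path_mass S y p a.
Proof. by rewrite /=; case: (S x). Qed.

Lemma path_mass_nil S x a : path_mass S x [::] a = 0.
Proof. by []. Qed.

Definition seq_mass S s : {linear V -> V} :=
  if s is x :: p then path_mass S x p else zero_linear.

(** Refining a subdivision does not change the sum: a new point splits A on one piece
    additively, and beyond the last point S is empty. *)
Lemma path_mass_insert S x p z a : path <=%O x p -> (x <= z)%O ->
  (forall t t', (x <= t)%O -> (t <= t')%O ->
    (forall z, z \in p -> ~~ (t < z <= t')%O) -> S t = S t') ->
  (forall t, (x <= t)%O -> (forall z, z \in p -> (z <= t)%O) -> S t = false) ->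
  path_mass S x (insert z p) a = path_mass S x p a.
Proof.
elim: p x => [|y p IH] x.
  move=> _ xz _ h; have -> : insert z [::] = [:: z] by [].
  by rewrite path_mass_cons h // path_mass_nil addr0.
move=> /andP[xy yp] xz h1 h2.
have yw w : w \in y :: p -> (y <= w)%O.
  rewrite in_cons => /predU1P[->//|wp].
  by have /allP := order_path_min le_trans yp; apply.
have -> : insert z (y :: p) = if (z <= y)%O then z :: y :: p else y :: insert z p by [].
have [zy|yz] := leP z y.
  rewrite !path_mass_cons addrA; congr (_ + _).
  have [->|zNy] := eqVneq z y; first by rewrite additive_refl if_same addr0.
  (* No point of the subdivision lies in (x, z], so S is constant there. *)
  have -> : S z = S x.
    apply/esym/h1 => // w /yw ywle; apply/negP => /andP[_ wz].
    by move: zNy; rewrite eq_le zy (le_trans ywle wz).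
  by case: (S x); rewrite ?addr0 // -A_additive.
rewrite !path_mass_cons; congr (_ + _); apply: IH => //; first exact: ltW.
- move=> t t' yt tt' h; apply: h1 => //; first exact: le_trans xy yt.
  move=> w; rewrite in_cons => /predU1P[->|]; last exact: h.
  by rewrite ltNge yt.
- move=> t yt h; apply: h2 => //; first exact: le_trans xy yt.
  by move=> w; rewrite in_cons => /predU1P[->|]; last exact: h.
Qed.

Lemma seq_mass_insert S s z a : sorted <=%O s -> adapted s S ->
  seq_mass S (insert z s) a = seq_mass S s a.
Proof.
case: s => [//|x p] xp [h1 h2 h3].
have xw w : w \in x :: p -> (x <= w)%O.
  rewrite in_cons => /predU1P[->//|wp].
  by have /allP := order_path_min le_trans xp; apply.
have -> : insert z (x :: p) = if (z <= x)%O then z :: x :: p else x :: insert z p by [].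
have [zx|xz] := leP z x; rewrite /seq_mass.
  rewrite path_mass_cons; have [->|zNx] := eqVneq z x.
    by rewrite additive_refl if_same add0r.
  rewrite h2 ?add0r // => w /xw; apply: lt_le_trans.
  by rewrite lt_neqAle zNx.
apply: path_mass_insert => //; first exact: ltW.
- move=> t t' xt tt' h; apply: h1 => // w.
  by rewrite in_cons => /predU1P[->|]; [rewrite ltNge xt|exact: h].
- move=> t xt h; apply: h3 => w.
  by rewrite in_cons => /predU1P[->|] //; exact: h.
Qed.

Lemma seq_mass_foldr_insert S s s' a : sorted <=%O s -> adapted s S ->
  [/\ sorted <=%O (foldr insert s s'), perm_eq (foldr insert s s') (s' ++ s)
    & seq_mass S (foldr insert s s') a = seq_mass S s a].
Proof.
move=> hs aS; elim: s' => [|z s' [IH1 IH2 IH3]] //=; split.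
- exact: sorted_insert.
- by rewrite (permPl (perm_insert _ _)) /= perm_cons.
- rewrite seq_mass_insert //; apply: adapted_subset aS => x xs.
  by rewrite (perm_mem IH2) mem_cat xs orbT.
Qed.

(** Both subdivisions have the same common refinement. *)
Lemma seq_mass_adapted S s s' a : sorted <=%O s -> adapted s S ->
  sorted <=%O s' -> adapted s' S -> seq_mass S s a = seq_mass S s' a.
Proof.
move=> hs aS hs' aS'.
have [h1 h2 <-] := seq_mass_foldr_insert s' a hs aS.
have [k1 k2 <-] := seq_mass_foldr_insert s a hs' aS'.
suff -> : foldr insert s s' = foldr insert s' s by [].
apply: (sorted_eq le_trans le_anti) => //.
by rewrite (permPl h2) perm_catC perm_sym.
Qed.

(** Sets that are not finite unions of intervals get mass 0.  Toggling an interval maps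
    such sets to such sets, so the estimates below hold for every S. *)
Definition mass S : {linear V -> V} :=
  seq_mass S (xget [::] [set s | sorted <=%O s /\ adapted s S]).

Lemma massE S s a : sorted <=%O s -> adapted s S -> mass S a = seq_mass S s a.
Proof.
move=> hs aS; rewrite /mass; case: xgetP => [s' -> [hs' aS']|/(_ s)[]//].
exact: seq_mass_adapted.
Qed.

Lemma mass_not_elementary S a : ~ elementary S -> mass S a = 0.
Proof.
move=> nS; rewrite /mass; case: xgetP => [s -> [hs aS]|_] //.
by case: nS; exists (xget [::] [set s | sorted <=%O s /\ adapted s S]).
Qed.

Lemma mass_set0 a : mass (fun=> false) a = 0.
Proof. by rewrite (@massE _ [::]). Qed.

Lemma mass_itv u v a : (u <= v)%O -> mass (toggle u v (fun=> false)) a = A u v a.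
Proof.
move=> uv; rewrite (@massE _ [:: u; v]); first last.
- apply: adapted_toggle; rewrite ?in_cons ?eqxx ?orbT //; exact: adapted_set0.
- by rewrite /= uv.
rewrite /seq_mass path_mass_cons path_mass_nil addr0 /toggle /itv_indicator lexx /=.
have [uv'|vu] := ltP u v; first by [].
by have -> : v = u; [apply: le_anti; rewrite uv vu|rewrite additive_refl].
Qed.

Lemma mass_ind (P : (V -> V) -> Prop) :
  P (fun=> 0) -> (forall f g, P f -> P g -> P (fun a => f a + g a)) ->
  (forall u v, (u <= v)%O -> P (A u v)) ->
  forall S, P (mass S).
Proof.
move=> P0 PD PA S; rewrite /mass; set s := xget _ _.
have hs : sorted <=%O s by rewrite /s; case: xgetP => // ? _ [].
case: s hs => [//|x p] /=; elim: p x => [//|y p IH] x /= /andP[xy yp].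
rewrite /path_mass -/path_mass; apply: PD; [case: (S x) => //; exact: PA|exact: IH].
Qed.

Variable l : Omega -> Omega -> R.
Hypothesis l_ge0 : forall u v, (u <= v)%O -> 0 <= l u v.
Hypothesis l_superadditive : forall u v w, (u <= v)%O -> (v <= w)%O ->
  l u v + l v w <= l u w.
Hypothesis A_le : forall u v, (u <= v)%O -> forall a, normR (A u v a) <= l u v * normR a.

(** The part of the length of x :: p that lies in [u, v). *)
Fixpoint path_length u v x p : R :=
  if p is y :: p' then (if itv_indicator u v x then l x y else 0) + path_length u v y p'
  else 0.

Lemma path_mass_toggle_le u v S x p a : path <=%O x p ->
  normR (path_mass (toggle u v S) x p a - path_mass S x p a) <= path_length u v x p * normR a.
Proof.
elim: p x => [|y p IH] x; first by rewrite !path_mass_nil subrr normR0 mul0r.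
move=> /andP[xy yp]; rewrite !path_mass_cons.
rewrite opprD addrACA mulrDl; apply: le_trans (ler_normRD _ _) _; apply: lerD; last exact: IH.
rewrite /toggle; case: (itv_indicator u v x); case: (S x) => /=;
  rewrite ?subrr ?subr0 ?sub0r ?normRN ?normR0 ?mul0r //; exact: A_le.
Qed.

Lemma path_length_ge u v x p : (v <= x)%O -> path <=%O x p -> path_length u v x p = 0.
Proof.
elim: p x => //= y p IH x vx /andP[xy yp].
by rewrite IH // ?(le_trans vx) // /itv_indicator ltNge vx andbF addr0.
Qed.

(** The pieces inside [u, v) are consecutive, and superadditivity merges them from the
    right; the maximum allows the induction to start before u as well as after it. *)
Lemma path_length_le u v x p : path <=%O x p -> (x <= v)%O ->
  (u <= x)%O || (u \in p) -> v \in x :: p -> (u <= v)%O ->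
  path_length u v x p <= l (Order.max x u) v.
Proof.
elim: p x => [|y p IH] x xp xv ux vp uv.
  by rewrite /= l_ge0 // ge_max xv uv.
move: xp => /= /andP[xy yp].
have [vx|xv'] := leP v x.
  rewrite path_length_ge // ?(le_trans vx) // /itv_indicator ltNge vx andbF addr0.
  by rewrite l_ge0 // ge_max xv uv.
have ymin w : w \in y :: p -> (y <= w)%O.
  rewrite in_cons => /predU1P[->//|wp].
  by have /allP := order_path_min le_trans yp; apply.
have vyp : v \in y :: p.
  by move: vp; rewrite in_cons => /predU1P[vx|//]; move: xv'; rewrite vx ltxx.
have yv := ymin _ vyp; rewrite /itv_indicator xv' andbT.
have [ux'|xu] := leP u x.
  apply: le_trans (l_superadditive xy yv).
  have uy : (u <= y)%O := le_trans ux' xy.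
  rewrite lerD2l; apply: le_trans (IH y yp yv _ vyp uv) _; first by rewrite uy.
  by rewrite max_l.
have uyp : u \in y :: p by move: ux; rewrite leNgt xu.
have yu := ymin _ uyp.
rewrite add0r; apply: le_trans (IH y yp yv _ vyp uv) _.
  by move: uyp; rewrite in_cons => /predU1P[->|->]; rewrite ?lexx ?orbT.
by rewrite max_r.
Qed.

(** On a subdivision through u and v, toggling changes the sum only on pieces inside
    [u, v), by plus or minus A on each of them. *)
Lemma mass_toggle_le u v S a : (u <= v)%O ->
  normR (mass (toggle u v S) a - mass S a) <= l u v * normR a.
Proof.
move=> uv; have [[s hs aS]|nS] := pselect (elementary S); last first.
  rewrite !mass_not_elementary ?subrr ?normR0 ?mulr_ge0 ?normR_ge0 ?l_ge0 //.
  by move=> /(elementary_toggle u v); rewrite toggleK.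
have [s' hs' [us' vs' aS']] : exists2 s', sorted <=%O s' &
    [/\ u \in s', v \in s' & adapted s' S].
  exists (insert u (insert v s)); first exact/sorted_insert/sorted_insert.
  split.
  - by rewrite mem_insert mem_head.
  - by rewrite mem_insert in_cons mem_insert mem_head orbT.
  - apply: adapted_subset aS => z zs.
    by rewrite mem_insert in_cons mem_insert in_cons zs !orbT.
rewrite !(@massE _ s') //; last exact: adapted_toggle.
case: s' hs' us' vs' {aS'} => //= x p xp us' vs'.
apply: le_trans (path_mass_toggle_le _ _ _ _ xp) _; apply: ler_wpM2r; first exact: normR_ge0.
have xmin w : w \in x :: p -> (x <= w)%O.
  rewrite in_cons => /predU1P[->//|wp].
  by have /allP := order_path_min le_trans xp; apply.
apply: le_trans (path_length_le xp (xmin _ vs') _ vs' uv) _.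
  by move: us'; rewrite in_cons => /predU1P[->|->]; rewrite ?lexx ?orbT.
by rewrite max_r // xmin.
Qed.

End Mass.

(** * The space of bounded uniformly continuous functions *)

Section UniformlyContinuousFunctions.
Context {R : realType} {X : Type} (near : R -> X -> X -> Prop) (V : completeNormedModType R[i]).

Definition bounded_uniform (f : X -> V) :=
  (exists M : R, forall x, normR (f x) <= M) /\
  forall e : R, 0 < e ->
    exists2 r : R, 0 < r & forall x y, near r x y -> normR (f x - f y) <= e.

(** Lipschitz on bounded sets, as multiplication is; enough to act on bounded functions. *)
Definition locally_lipschitz2 (F : V -> V -> V) := forall M : R, exists2 K : R, 0 <= K &
  forall a b a' b', normR a <= M -> normR b <= M -> normR a' <= M -> normR b' <= M ->
    normR (F a b - F a' b') <= K * (normR (a - a') + normR (b - b')).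

Hypothesis near_le : forall r s x y, r <= s -> near r x y -> near s x y.

Lemma bounded_uniform_lift2 (F : V -> V -> V) (f g : X -> V) : locally_lipschitz2 F ->
  bounded_uniform f -> bounded_uniform g -> bounded_uniform (fun x => F (f x) (g x)).
Proof.
move=> lipF [[Mf hMf] uf] [[Mg hMg] ug].
pose M := `|Mf| + `|Mg|.
have fM x : normR (f x) <= M.
  by apply: le_trans (hMf x) _; apply: le_trans (ler_norm _) _; rewrite lerDl.
have gM x : normR (g x) <= M.
  by apply: le_trans (hMg x) _; apply: le_trans (ler_norm _) _; rewrite lerDr.
have [K K0 hK] := lipF M; split.
  exists (K * (M + M) + normR (F 0 0)) => x.
  have M0 : 0 <= M by rewrite addr_ge0.
  have := hK _ _ _ _ (fM x) (gM x); move/(_ 0 0); rewrite normR0 !subr0 => /(_ M0 M0) h.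
  rewrite -[F (f x) (g x)](subrK (F 0 0)); apply: le_trans (ler_normRD _ _) _.
  rewrite lerD2r; apply: le_trans h _; apply: ler_wpM2l => //; exact: lerD.
move=> e e0; pose e' := e / (2 * (K + 1)).
have K1 : 0 < K + 1 by rewrite ltr_wpDl.
have e'0 : 0 < e' by rewrite divr_gt0 // mulr_gt0.
have [r r0 hr] := uf _ e'0; have [s s0 hs] := ug _ e'0.
exists (Num.min r s); first by rewrite lt_min r0 s0.
move=> x y xy; apply: le_trans (hK _ _ _ _ (fM x) (gM x) (fM y) (gM y)) _.
have hx : normR (f x - f y) <= e'.
  by apply: hr; apply: near_le xy; rewrite ge_min lexx.
have hy : normR (g x - g y) <= e'.
  by apply: hs; apply: near_le xy; rewrite ge_min lexx orbT.
have -> : e = (K + 1) * (e' + e') by rewrite /e'; field; rewrite gt_eqF.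
apply: ler_pM => //; rewrite ?addr_ge0 ?normR_ge0 ?lerDl //; exact: lerD.
Qed.

Lemma bounded_uniform_cst (a : V) : bounded_uniform (fun=> a).
Proof.
split; first by exists (normR a).
by move=> e e0; exists 1 => // x y _; rewrite subrr normR0 ltW.
Qed.

Lemma locally_lipschitz2_linear (f g : V -> V) (K : R) :
  (forall a b, f (a - b) = f a - f b) -> (forall a b, g (a - b) = g a - g b) ->
  (forall a, normR (f a) <= K * normR a) -> (forall a, normR (g a) <= K * normR a) ->
  locally_lipschitz2 (fun a b => f a + g b).
Proof.
move=> fB gB fK gK M; exists `|K| => // a b a' b' _ _ _ _.
rewrite opprD addrACA -fB -gB mulrDr; apply: le_trans (ler_normRD _ _) _.
by apply: lerD; [apply: le_trans (fK _) _|apply: le_trans (gK _) _];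
  apply: ler_wpM2r; rewrite ?normR_ge0 ?ler_norm.
Qed.

Lemma bounded_uniformD (f g : X -> V) :
  bounded_uniform f -> bounded_uniform g -> bounded_uniform (fun x => f x + g x).
Proof.
apply: bounded_uniform_lift2; apply: (@locally_lipschitz2_linear id id 1) => // a;
  by rewrite mul1r.
Qed.

Lemma bounded_uniformZ (c : R[i]) (f : X -> V) :
  bounded_uniform f -> bounded_uniform (fun x => c *: f x).
Proof.
move=> hf; pose K := complex.Re `|c|.
have K0 : 0 <= K by exact: (@normR_ge0 _ (R[i]^o)).
have := bounded_uniform_lift2 _ hf (bounded_uniform_cst 0).
move=> /(_ (fun a b => c *: a + 0 *: b)) h.
rewrite (_ : (fun x => _) = (fun x => c *: f x + 0 *: 0)); last first.
  by apply: funext => x; rewrite scale0r addr0.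
apply: h; apply: (@locally_lipschitz2_linear _ _ K) => a *; rewrite ?scalerBr ?normRZ //.
by rewrite normr0 /= mul0r mulr_ge0 ?normR_ge0.
Qed.

Lemma bounded_uniformN (f : X -> V) : bounded_uniform f -> bounded_uniform (fun x => - f x).
Proof.
by move=> [[M hM] uf]; split; [exists M => x; rewrite normRN
  |move=> e /uf[r r0 hr]; exists r => // x y /hr; rewrite -opprD normRN].
Qed.

End UniformlyContinuousFunctions.

(** Closeness up to a radius is bundled with its monotonicity so that the function space
    depends on a single parameter; sums and products need it to take the smaller of two radii. *)
Record closeness (R : realType) (X : Type) := Closeness {
  close :> R -> X -> X -> Prop ;
  close_le : forall r s x y, r <= s -> close r x y -> close s x y }.

Section FunctionSpace.
Context {R : realType} {X : Type} (N : closeness R X) (V : completeNormedModType R[i]).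

Record buc := Buc { buc_fun :> X -> V ; bucP : bounded_uniform N buc_fun }.

Lemma bucE (f g : buc) : f =1 g -> f = g.
Proof.
case: f g => [f uf] [g ug] /= /funext fg; move: ug; rewrite -fg => ug.
by congr Buc; exact: Prop_irrelevance.
Qed.

HB.instance Definition _ := gen_eqMixin buc.
HB.instance Definition _ := gen_choiceMixin buc.

Let zero := Buc (bounded_uniform_cst N (0 : V)).
Let add (f g : buc) := Buc (bounded_uniformD (@close_le _ _ N) (bucP f) (bucP g)).
Let opp (f : buc) := Buc (bounded_uniformN (bucP f)).
Let scale c (f : buc) := Buc (bounded_uniformZ (@close_le _ _ N) c (bucP f)).

Let addA : associative add. Proof. by move=> f g h; apply: bucE => x; exact: addrA. Qed.
Let addC : commutative add. Proof. by move=> f g; apply: bucE => x; exact: addrC. Qed.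
Let add0 : left_id zero add. Proof. by move=> f; apply: bucE => x; exact: add0r. Qed.
Let addN : left_inverse zero opp add.
Proof. by move=> f; apply: bucE => x; exact: addNr. Qed.

HB.instance Definition _ := GRing.isZmodule.Build buc addA addC add0 addN.

Let scaleA a b f : scale a (scale b f) = scale (a * b) f.
Proof. by apply: bucE => x; exact: scalerA. Qed.
Let scale1 : left_id 1 scale. Proof. by move=> f; apply: bucE => x; exact: scale1r. Qed.
Let scaleDr : right_distributive scale +%R.
Proof. by move=> c f g; apply: bucE => x; exact: scalerDr. Qed.
Let scaleDl f : {morph scale^~ f : a b / a + b}.
Proof. by move=> a b; apply: bucE => x; exact: scalerDl. Qed.

HB.instance Definition _ := GRing.Zmodule_isLmodule.Build R[i] buc scaleA scale1 scaleDr scaleDl.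

Lemma bucDE (f g : buc) x : (f + g) x = f x + g x. Proof. by []. Qed.
Lemma bucNE (f : buc) x : (- f) x = - f x. Proof. by []. Qed.
Lemma bucZE c (f : buc) x : (c *: f) x = c *: f x. Proof. by []. Qed.

Definition sup_norm (f : buc) : R := sup [set normR (f x) | x in setT].

Lemma sup_norm_ge (f : buc) x : normR (f x) <= sup_norm f.
Proof.
apply: sup_upper_bound; last by exists x.
split; first by exists (normR (f x)); exists x.
by have [[M hM] _] := bucP f; exists M => _ [y _ <-].
Qed.

Lemma sup_norm_le (f : buc) M : 0 <= M -> (forall x, normR (f x) <= M) -> sup_norm f <= M.
Proof.
move=> M0 hM; have [[x]|X0] := pselect (inhabited X).
  by apply: ge_sup; [exists (normR (f x)); exists x|move=> _ [y _ <-]].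
rewrite /sup_norm (_ : [set _ | _ in _] = set0) ?sup0 //.
by apply/seteqP; split=> // z [y _ _]; exfalso; exact: X0 (inhabits y).
Qed.

Lemma sup_norm_ge0 (f : buc) : 0 <= sup_norm f.
Proof.
have [[x]|X0] := pselect (inhabited X).
  exact: le_trans (normR_ge0 _) (sup_norm_ge f x).
rewrite /sup_norm (_ : [set _ | _ in _] = set0) ?sup0 //.
by apply/seteqP; split=> // z [y _ _]; exfalso; exact: X0 (inhabits y).
Qed.

Let norm (f : buc) : R[i] := (sup_norm f)%:C%C.

Let normD f g : norm (f + g) <= norm f + norm g.
Proof.
rewrite -rmorphD lecR; apply: sup_norm_le => [|x]; first by rewrite addr_ge0 ?sup_norm_ge0.
by apply: le_trans (ler_normRD _ _) _; apply: lerD; exact: sup_norm_ge.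
Qed.

Let norm_scale_le (c : R[i]) f : sup_norm (c *: f) <= complex.Re `|c| * sup_norm f.
Proof.
have c0 : 0 <= complex.Re `|c| by exact: (@normR_ge0 _ (R[i]^o)).
apply: sup_norm_le => [|x]; first by rewrite mulr_ge0 ?sup_norm_ge0.
by rewrite normRZ; apply: ler_wpM2l => //; exact: sup_norm_ge.
Qed.

Let normZ (c : R[i]) f : norm (c *: f) = `|c| * norm f.
Proof.
have cE : `|c| = (complex.Re `|c|)%:C%C by exact: (@normRE _ (R[i]^o)).
rewrite cE -rmorphM; congr (_%:C)%C; apply/eqP; rewrite eq_le norm_scale_le andTb.
have [->|c0] := eqVneq c 0; first by rewrite normr0 mul0r sup_norm_ge0.
have := norm_scale_le c^-1 (c *: f); rewrite scalerA mulVf // scale1r.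
rewrite normfV {1}cE -fmorphV /= => h.
have c1 : 0 < complex.Re `|c| by rewrite -ltcR -cE normr_gt0.
by rewrite -ler_pdivlMl.
Qed.

Let norm0 f : norm f = 0 -> f = 0.
Proof.
move=> /complexI f0; apply: bucE => x; apply: normR_le0.
by rewrite -f0; exact: sup_norm_ge.
Qed.

HB.instance Definition _ := Lmodule_isNormed.Build R[i] buc normD normZ norm0.

Lemma normR_buc_ge (f : buc) x : normR (f x) <= normR f. Proof. exact: sup_norm_ge. Qed.

Lemma normR_bucB_ge (f g : buc) x : normR (f x - g x) <= normR (f - g).
Proof. exact: sup_norm_ge (f - g) x. Qed.

Lemma normR_buc_le (f : buc) M : 0 <= M -> (forall x, normR (f x) <= M) -> normR f <= M.
Proof. exact: sup_norm_le. Qed.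

(** The limit is taken pointwise; it is uniform because the Cauchy condition bounds all
    points at once, and uniform limits inherit boundedness and uniform continuity. *)
Lemma buc_complete (F : set_system buc) : ProperFilter F -> cauchy F -> cvg F.
Proof.
move=> FF /cauchyP cF.
have cF' (e : R) : 0 < e -> exists f0 : buc, F [set h : buc | normR (f0 - h) <= e].
  move=> e0; have e0' : 0 < e%:C%C :> R[i] by rewrite ltcR.
  have [f0 Ff0] := cF _ e0'; exists f0; apply: filterS Ff0 => h.
  by rewrite -ball_normE /ball_ /= normRE ltcR => /ltW.
have cFx x : cvg ((fun f : buc => f x) @ F).
  apply: cauchy_cvg; apply/cauchyP => e /gt0_real_complex[r r0 ->].
  have r20 : 0 < r / 2 by rewrite divr_gt0.
  have [f0 Ff0] := cF' _ r20; exists (f0 x).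
  change (F [set h : buc | ball (f0 x) r%:C%C (h x)]); apply: filterS Ff0 => h /= hr.
  rewrite -ball_normE /ball_ /= normRE ltcR.
  apply: le_lt_trans (normR_bucB_ge f0 h x) _.
  by apply: le_lt_trans hr _; lra.
pose g x := lim ((fun f : buc => f x) @ F).
have gP (e : R) (f0 : buc) : 0 < e -> F [set h : buc | normR (f0 - h) <= e] ->
    forall x, normR (f0 x - g x) <= e.
  move=> e0 Ff0 x; apply/ler_addgt0Pr => e' e'0.
  have /cvg_normRP/(_ _ e'0) Fg : (fun f : buc => f x) @ F --> g x by exact: cFx.
  have [h [/= h1 h2]] := filter_ex (filterI Ff0 Fg).
  apply: le_trans (ler_normRBD _ (h x) _) _; apply: lerD; last by rewrite normRB.
  exact: le_trans (normR_bucB_ge f0 h x) _.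
have gbuc : bounded_uniform N g.
  split.
    have [f0 Ff0] := cF' 1 ltr01; exists (normR f0 + 1) => x.
    have := ler_normRD (g x - f0 x) (f0 x); rewrite subrK normRB.
    by have := gP _ _ ltr01 Ff0 x; have := normR_buc_ge f0 x; lra.
  move=> e e0; have e30 : 0 < e / 3 by rewrite divr_gt0.
  have [f0 Ff0] := cF' _ e30; have [_ /(_ _ e30)[r r0 hr]] := bucP f0.
  exists r => // x y /hr h; have := gP _ _ e30 Ff0.
  move=> gf; have := gf x; have := gf y.
  have := ler_normRBD (g x) (f0 x) (g y); have := ler_normRBD (f0 x) (f0 y) (g y).
  by rewrite (normRB (g x) (f0 x)); lra.
apply/cvg_ex; exists (Buc gbuc); apply/cvg_normRP => e e0.
have e20 : 0 < e / 2 by rewrite divr_gt0.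
have [f0 Ff0] := cF' _ e20; apply: filterS (Ff0) => h /= hh.
apply: le_trans (ler_normRBD _ f0 _) _.
suff : normR (Buc gbuc - f0) <= e / 2 by lra.
apply: normR_buc_le => [|x]; first exact: ltW.
by rewrite normRB; exact: gP.
Qed.

HB.instance Definition _ := Uniform_isComplete.Build buc buc_complete.

End FunctionSpace.

(** * Square roots in a C*-algebra *)

Section CStarBasics.
Context {R : realType} {A : cstarAlgType R}.
Implicit Types (a b c x y z : A) (s t : R) (k : R[i]).

Local Notation one := (@cone R A).
Local Notation "t ^&" := (t%:C%C : R[i]) (at level 2, format "t ^&").

Lemma cmulNl a b : (- a) ** b = - (a ** b).
Proof. by rewrite -scaleN1r cmulZl scaleN1r. Qed.
Lemma cmulNr a b : a ** (- b) = - (a ** b).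
Proof. by rewrite -scaleN1r cmulZr scaleN1r. Qed.
Lemma cmulBl a b c : (a - b) ** c = a ** c - b ** c.
Proof. by rewrite cmulDl cmulNl. Qed.
Lemma cmulBr a b c : c ** (a - b) = c ** a - c ** b.
Proof. by rewrite cmulDr cmulNr. Qed.
Lemma cmul0l a : 0 ** a = 0.
Proof. by apply: (@addrI _ (0 ** a)); rewrite -cmulDl !addr0. Qed.
Lemma cmul0r a : a ** 0 = 0.
Proof. by apply: (@addrI _ (a ** 0)); rewrite -cmulDr !addr0. Qed.

Lemma starN a : star (- a) = - star a.
Proof. by rewrite -scaleN1r starZ rmorphN1 scaleN1r. Qed.
Lemma starB a b : star (a - b) = star a - star b.
Proof. by rewrite starD starN. Qed.
Lemma star0 : star 0 = 0 :> A.
Proof. by apply: (@addrI _ (star 0)); rewrite -starD !addr0. Qed.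
Lemma starZr t a : star (t^& *: a) = t^& *: star a.
Proof. by rewrite starZ conjc_real. Qed.
Lemma star1 : star one = one.
Proof.
have : star (star one ** one) = star one ** one by rewrite starM starK.
by rewrite !cmul1r starK => <-.
Qed.

Lemma normR_cmul_le a b : normR (a ** b) <= normR a * normR b.
Proof. by rewrite -lecR rmorphM /= -!normRE norm_cmul_le. Qed.
Lemma normR_cmul_star a : normR (star a ** a) = normR a ^+ 2.
Proof. by apply: (@complexI R); rewrite rmorphXn /= -!normRE norm_cmul_star. Qed.

Lemma normR_star a : normR (star a) = normR a.
Proof.
have le b : normR b <= normR (star b).
  have [->|b0] := eqVneq (normR b) 0; first exact: normR_ge0.
  have bgt0 : 0 < normR b by rewrite lt_def b0 normR_ge0.
  rewrite -(ler_pM2r bgt0) -expr2 -normR_cmul_star; exact: normR_cmul_le.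
by apply/eqP; rewrite eq_le le andbT; have := le (star a); rewrite starK.
Qed.

Lemma normR1_le : normR one <= 1.
Proof.
have := normR_cmul_star one; rewrite star1 cmul1l => h.
by have := normR_ge0 one; nra.
Qed.

Lemma normR_scale1_le t : 0 <= t -> normR (t^& *: one) <= t.
Proof.
by move=> t0; rewrite normRZp // -[leRHS]mulr1; apply: ler_wpM2l; rewrite ?normR1_le.
Qed.

Lemma sa_sq_eq0 a : star a = a -> a ** a = 0 -> a = 0.
Proof.
move=> sa aa; apply: normR0_eq0; have := normR_cmul_star a.
by rewrite sa aa normR0 => /esym/eqP; rewrite sqrf_eq0 => /eqP.
Qed.

Lemma star_cvg (u : nat -> A) a : u @ \oo --> a -> (star \o u) @ \oo --> star a.
Proof.
by apply: (@bounded_linear_cvg _ _ _ _ 1) => [x y|x];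
  rewrite ?starB ?mul1r ?normR_star.
Qed.

Lemma cmul_cvg (u v : nat -> A) a b : u @ \oo --> a -> v @ \oo --> b ->
  (fun n => u n ** v n) @ \oo --> a ** b.
Proof.
move=> ua vb; have /cvgn_normRP := ua; have /cvgn_normRP := vb => hv hu.
apply/cvgn_normRP => e e0.
pose K := normR a + normR b + 1.
have K0 : 0 < K by rewrite ltr_wpDl // addr_ge0 ?normR_ge0.
pose e' := Num.min 1 (e / (2 * K)).
have e'0 : 0 < e' by rewrite lt_min ltr01 divr_gt0 // mulr_gt0.
have [N hN] := hu _ e'0; have [M hM] := hv _ e'0.
exists (maxn N M) => n; rewrite geq_max => /andP[/hN un /hM vn].
have -> : a ** b - u n ** v n = a ** (b - v n) + (a - u n) ** v n.
  by rewrite cmulBr cmulBl subrKA.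
apply: le_trans (ler_normRD _ _) _.
have h1 := normR_cmul_le a (b - v n); have h2 := normR_cmul_le (a - u n) (v n).
have e'1 : e' <= 1 by rewrite ge_min lexx.
have vnb : normR (v n) <= normR b + 1.
  by have := ler_normRD (v n - b) b; rewrite subrK normRB; lra.
have h3 : normR (a ** (b - v n)) <= normR a * e'.
  by apply: le_trans h1 _; apply: ler_wpM2l; rewrite ?normR_ge0.
have h4 : normR ((a - u n) ** v n) <= e' * (normR b + 1).
  by apply: le_trans h2 _; apply: ler_pM; rewrite ?normR_ge0.
have h5 : e' * (2 * K) <= e.
  by rewrite -ler_pdivlMr ?mulr_gt0 // ge_min lexx orbT.
apply: le_trans (lerD h3 h4) _; apply: le_trans h5; rewrite /K.
have := normR_ge0 a; have := normR_ge0 b; nra.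
Qed.

(** The scalar iteration for 1 - sqrt(1 - x) at x = 1. *)
Fixpoint sqrt_majorant n : R :=
  if n is m.+1 then 2^-1 * (1 + sqrt_majorant m ^+ 2) else 0.

Lemma sqrt_majorant_bounds n : [/\ 0 <= sqrt_majorant n, sqrt_majorant n <= 1
  & sqrt_majorant n <= sqrt_majorant n.+1].
Proof.
elim: n => [|n [h0 h1 h2]]; first by split; rewrite /= ?ler01 //; lra.
by split; move: h0 h1 h2 => /=; nra.
Qed.

Lemma sqrt_majorant_cvg : cvgn sqrt_majorant.
Proof.
apply: nondecreasing_is_cvgn.
  by apply/nondecreasing_seqP => n; have [] := sqrt_majorant_bounds n.
by exists 1 => _ [n _ <-]; have [] := sqrt_majorant_bounds n.
Qed.

(** The fixed point y of y = (x + y^2) / 2 satisfies (1 - y)^2 = 1 - x. *)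
Fixpoint sqrt_iter x n : A :=
  if n is m.+1 then (2^-1 : R)^& *: (x + sqrt_iter x m ** sqrt_iter x m) else 0.

Lemma sqrt_iter_le x n : normR x <= 1 -> normR (sqrt_iter x n) <= sqrt_majorant n.
Proof.
move=> x1; elim: n => [|n IH]; first by rewrite normR0.
rewrite /= normRZp //; apply: ler_wpM2l => //; apply: le_trans (ler_normRD _ _) _.
apply: lerD => //; apply: le_trans (normR_cmul_le _ _) _.
by rewrite expr2; apply: ler_pM; rewrite ?normR_ge0.
Qed.

Lemma commute_sqrt_iter x z n : z ** x = x ** z -> z ** sqrt_iter x n = sqrt_iter x n ** z.
Proof.
move=> zx; elim: n => [|n IH] /=; first by rewrite cmul0l cmul0r.
by rewrite cmulZl cmulZr cmulDl cmulDr zx cmulA IH -cmulA IH cmulA.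
Qed.

(** y' - y = ((y - z) y + z (y - z)) / 2 for consecutive iterates z, y, y': every factor is
    dominated by its scalar counterpart.  This covers |x| = 1, where the iteration is no
    longer a strict contraction. *)
Lemma sqrt_iter_increment x n : normR x <= 1 ->
  normR (sqrt_iter x n.+1 - sqrt_iter x n) <= sqrt_majorant n.+1 - sqrt_majorant n.
Proof.
move=> x1; elim: n => [|n IH].
  by rewrite /= cmul0l !subr0 addr0 normRZp // expr0n addr0; apply: ler_wpM2l.
have -> : sqrt_iter x n.+2 - sqrt_iter x n.+1 = (2^-1 : R)^& *:
    ((sqrt_iter x n.+1 - sqrt_iter x n) ** sqrt_iter x n.+1 +
     sqrt_iter x n ** (sqrt_iter x n.+1 - sqrt_iter x n)).
  rewrite cmulBl cmulBr subrKA -/(sqrt_iter x n.+2).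
  rewrite [sqrt_iter x n.+2]/(_ *: _) [X in _ - X = _]/(_ *: _) -scalerBr.
  by rewrite opprD addrACA subrr add0r.
have -> : sqrt_majorant n.+2 - sqrt_majorant n.+1 = 2^-1 *
   ((sqrt_majorant n.+1 - sqrt_majorant n) * sqrt_majorant n.+1 +
    sqrt_majorant n * (sqrt_majorant n.+1 - sqrt_majorant n)).
  have E m : sqrt_majorant m.+1 = 2^-1 * (1 + sqrt_majorant m ^+ 2) by [].
  by rewrite (E n.+1); have := E n; move: (sqrt_majorant n.+1) (sqrt_majorant n) => p q; lra.
rewrite normRZp //; apply: ler_wpM2l => //; apply: le_trans (ler_normRD _ _) _.
by apply: lerD; apply: le_trans (normR_cmul_le _ _) _; apply: ler_pM;
  rewrite ?normR_ge0 ?sqrt_iter_le.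
Qed.

(** The root commutes with everything that commutes with x, being a limit of polynomials
    in x. *)
Lemma sqrt_one_minus x : star x = x -> normR x <= 1 ->
  exists c, [/\ star c = c, normR (one - c) <= 1, c ** c = one - x
    & forall z, z ** x = x ** z -> z ** c = c ** z].
Proof.
move=> sx x1.
have /cvg_ex[y yP] : cvgn (sqrt_iter x).
  apply: cvg_dominated_increments sqrt_majorant_cvg => n.
  exact: sqrt_iter_increment.
have sy : star y = y.
  apply: limit_unique (star_cvg yP) _; rewrite (_ : star \o _ = sqrt_iter x) //.
  apply: funext => n /=; elim: n => [|n IH] /=; first exact: star0.
  by rewrite starZr starD starM sx IH.
have yy : y = (2^-1 : R)^& *: (x + y ** y).
  apply: limit_unique (_ : (fun n => sqrt_iter x n.+1) @ \oo --> y) _.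
    by move: yP; rewrite -(cvg_shiftS (sqrt_iter x)).
  by apply: cvgZl_tmp; apply: cvgD; [exact: cvg_cst|exact: cmul_cvg].
have y1 : normR y <= 1.
  apply: (@normR_lim_le _ _ _ (fun=> 1) _ _ yP); first exact: cvg_cst.
  move=> n; apply: le_trans (sqrt_iter_le n x1) _.
  by have [] := sqrt_majorant_bounds n.
exists (one - y); split.
- by rewrite starB star1 sy.
- by rewrite subKr.
- have y2 : y + y = x + y ** y.
    by rewrite {1 2}yy -scalerDl -rmorphD /= (_ : 2^-1 + 2^-1 = 1) ?scale1r //; field.
  rewrite cmulBl !cmulBr !cmul1l cmul1r opprB addrA addrAC -addrA.
  by rewrite -[in RHS](addrK (y ** y) x) -y2 !opprD !addrA opprK.
- move=> z zx; rewrite cmulBl cmulBr cmul1l cmul1r; congr (_ - _).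
  have h (u : nat -> A) a b : u @ \oo --> a -> (fun n => b ** u n) @ \oo --> b ** a.
    by move=> ua; apply: cmul_cvg => //; exact: cvg_cst.
  have h' (u : nat -> A) a b : u @ \oo --> a -> (fun n => u n ** b) @ \oo --> a ** b.
    by move=> ua; apply: cmul_cvg => //; exact: cvg_cst.
  apply: limit_unique (h _ _ z yP) _.
  rewrite (_ : (fun n => _) = (fun n => sqrt_iter x n ** z)); first exact: h'.
  by apply: funext => n; exact: commute_sqrt_iter.
Qed.

End CStarBasics.

(** * The positive cone of a C*-algebra *)

Section Positivity.
Context {R : realType} {A : cstarAlgType R}.
Implicit Types (a b c x y z : A) (s t : R) (k : R[i]).

Local Notation one := (@cone R A).
Local Notation "t ^&" := (t%:C%C : R[i]) (at level 2, format "t ^&").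
Local Notation ii := (Complex 0 1 : R[i]).

(** In spectral terms, the spectrum of a lies in [0, 2t].  Leaving t free makes the
    stability under sums immediate. *)
Definition norm_positive a := star a = a /\
  exists2 t : R, 0 <= t & normR (t^& *: one - a) <= t.

Lemma norm_positiveD a b : norm_positive a -> norm_positive b -> norm_positive (a + b).
Proof.
move=> [sa [s s0 hs]] [sb [t t0 ht]]; split; first by rewrite starD sa sb.
exists (s + t); first exact: addr_ge0.
rewrite rmorphD /= scalerDl opprD addrACA.
by apply: le_trans (ler_normRD _ _) _; exact: lerD.
Qed.

Lemma norm_positiveZ s a : 0 <= s -> norm_positive a -> norm_positive (s^& *: a).
Proof.
move=> s0 [sa [t t0 ht]]; split; first by rewrite starZr sa.
exists (s * t); first exact: mulr_ge0.
by rewrite rmorphM /= -scalerA -scalerBr normRZp //; apply: ler_wpM2l.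
Qed.

Lemma norm_positive_norm_sub a s : star a = a -> normR a <= s ->
  norm_positive (s^& *: one - a).
Proof.
move=> sa as'; split; first by rewrite starB starZr star1 sa.
by exists s; [exact: le_trans (normR_ge0 a) as'|rewrite subKr].
Qed.

Lemma sqrt_scalar_minus t x : star x = x -> normR x <= t ->
  exists c, [/\ norm_positive c, c ** c = t^& *: one - x
    & forall z, z ** x = x ** z -> z ** c = c ** z].
Proof.
move=> sx xt; have t0 : 0 <= t := le_trans (normR_ge0 x) xt.
have [t00|tN0] := eqVneq t 0.
  have x0 : x = 0 by apply: normR_le0; rewrite -t00.
  exists 0; split; last by move=> z _; rewrite cmul0l cmul0r.
    by split; [exact: star0|exists 0; rewrite // subr0 scale0r normR0].
  by rewrite cmul0l t00 x0 scale0r subr0.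
have tp : 0 < t by rewrite lt_def tN0.
have [] := @sqrt_one_minus R A ((t^-1)^& *: x).
- by rewrite starZr sx.
- by rewrite normRZp ?invr_ge0 // -(mulVf tN0); apply: ler_wpM2l; rewrite ?invr_ge0.
move=> c [sc c1 cc comm]; pose r := Num.sqrt t.
have r0 : 0 <= r by exact: sqrtr_ge0.
have rr : r * r = t by rewrite -expr2 sqr_sqrtr.
exists (r^& *: c); split.
- split; first by rewrite starZr sc.
  exists r => //; rewrite -scalerBr normRZp // -[leRHS]mulr1.
  exact: ler_wpM2l.
- rewrite cmulZl cmulZr scalerA -rmorphM /= rr cc scalerBr scalerA -rmorphM /=.
  by rewrite divff // scale1r.
- move=> z zx; rewrite cmulZl cmulZr comm // cmulZl cmulZr; congr (_ *: _); exact: zx.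
Qed.

Lemma norm_positive_sqrt a : norm_positive a ->
  exists c, [/\ norm_positive c, c ** c = a & forall z, z ** a = a ** z -> z ** c = c ** z].
Proof.
move=> [sa [t t0 ta]].
have [||c [pc cc comm]] := @sqrt_scalar_minus t (t^& *: one - a) => //.
  by rewrite starB starZr star1 sa.
exists c; split => //; first by rewrite cc subKr.
by move=> z za; apply: comm; rewrite cmulBl cmulBr cmulZl cmulZr cmul1l cmul1r za.
Qed.

(** For w = c + i d one has w^* w = c^2 + d^2, and c is the mean of w and w^*. *)
Lemma normR_le_sum_sq c d : star c = c -> star d = d -> c ** d = d ** c ->
  normR c ^+ 2 <= normR (c ** c + d ** d).
Proof.
move=> sc sd cd; pose w := c + ii *: d.
have sw : star w = c - ii *: d.
  rewrite starD sc starZ sd -scaleNr; congr (_ + _ *: _).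
  by apply/eqP; rewrite eq_complex /= oppr0 !eqxx.
have ww : star w ** w = c ** c + d ** d.
  rewrite sw cmulBl !cmulDr !cmulZl !cmulZr scalerA cd.
  rewrite (_ : ii * ii = -1); last by rewrite -expr2 sqr_i.
  by rewrite scaleN1r opprD opprK addrA addrK.
have cw : (2 : R)^& *: c = w + star w.
  rewrite sw addrACA subrr addr0 -[in RHS](scale1r c) -scalerDl; congr (_ *: _).
  by rewrite -rmorphD.
have : 2 * normR c <= normR w + normR (star w).
  by rewrite -normRZp // cw; exact: ler_normRD.
rewrite normR_star -ww normR_cmul_star => h.
by rewrite lerXn2r ?nnegrE ?normR_ge0 //; lra.
Qed.

(** With t = |c|^2, let d be the root of t - c^2; then |t - c^2| = |d^2| and c^2 + d^2 = t
    bounds d. *)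
Lemma norm_positive_sq c : star c = c -> norm_positive (c ** c).
Proof.
move=> sc; pose t := normR c ^+ 2.
have t0 : 0 <= t by exact: exprn_ge0 (normR_ge0 c).
have sc2 : star (c ** c) = c ** c by rewrite starM sc.
have [|d [[sd _] dd comm]] := @sqrt_scalar_minus t (c ** c) sc2.
  by rewrite /t expr2; exact: normR_cmul_le.
split=> //; exists t => //; rewrite -dd; apply: le_trans (normR_cmul_le _ _) _.
rewrite -expr2; apply: le_trans (normR_le_sum_sq sd sc _) _.
  by rewrite comm // cmulA.
by rewrite dd subrK; exact: normR_scale1_le.
Qed.

(** If a = c^2 and -a = d^2 with commuting roots, then c^2 + d^2 = 0 forces c = 0. *)
Lemma norm_positive_antisym a : norm_positive a -> norm_positive (- a) -> a = 0.
Proof.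
move=> pa pNa; have [c [[sc _] cc commc]] := norm_positive_sqrt pa.
have [d [[sd _] dd commd]] := norm_positive_sqrt pNa.
have cd : c ** d = d ** c.
  by apply: commd; rewrite cmulNl cmulNr -cc cmulA.
have := normR_le_sum_sq sc sd cd; rewrite cc dd subrr normR0.
rewrite exprn_even_le0 //= => /eqP/normR0_eq0 c0.
by rewrite -cc c0 cmul0l.
Qed.

(** If a = c^2 and |b| - a = d^2 with commuting roots, then |c|^2 <= |c^2 + d^2| <= |b|. *)
Lemma normR_mono a b : norm_positive a -> star b = b -> norm_positive (b - a) ->
  normR a <= normR b.
Proof.
move=> pa sb pab; have nb := norm_positive_norm_sub sb (lexx (normR b)).
have := norm_positiveD nb pab; rewrite addrA subrK => pNa.
have [c [[sc _] cc commc]] := norm_positive_sqrt pa.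
have [d [[sd _] dd commd]] := norm_positive_sqrt pNa.
have cd : c ** d = d ** c.
  by apply: commd; rewrite cmulBl cmulBr cmulZl cmulZr cmul1l cmul1r -cc cmulA.
have := normR_le_sum_sq sc sd cd; rewrite cc dd [a + _]addrC subrK => h.
apply: (@le_trans _ _ (normR c ^+ 2)).
  by rewrite -cc expr2; exact: normR_cmul_le.
by apply: le_trans h _; apply: normR_scale1_le; exact: normR_ge0.
Qed.

(** Twice this sum is the sum of the squares of a + a^* and i (a - a^* ). *)
Lemma norm_positive_star_sum a : norm_positive (star a ** a + a ** star a).
Proof.
pose u := a + star a; pose v := ii *: (a - star a).
have su : star u = u by rewrite starD starK addrC.
have sv : star v = v.
  rewrite starZ starB starK -[star a - a]opprB scalerN -scaleNr; congr (_ *: _).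
  by apply/eqP; rewrite eq_complex /= oppr0 opprK !eqxx.
have := norm_positiveD (norm_positive_sq su) (norm_positive_sq sv).
have -> : u ** u + v ** v = (2 : R)^& *: (star a ** a + a ** star a).
  rewrite /u /v cmulZl cmulZr scalerA (_ : ii * ii = -1); last by rewrite -expr2 sqr_i.
  rewrite scaleN1r cmulDl cmulBl !cmulBr !cmulDr.
  move: (a ** a) (a ** star a) (star a ** a) (star a ** star a) => p q r s.
  rewrite opprB opprB [r - s + _]addrC addrACA [q - p]addrC (addrACA p q) subrr add0r.
  rewrite (addrACA r s) subrr addr0 addrACA [q + r]addrC.
  by rewrite (_ : 2^& = 1 + 1) ?scalerDl ?scale1r // -rmorphD.
have h2 : 0 <= (2^-1 : R) by rewrite invr_ge0.
move/(norm_positiveZ h2); rewrite scalerA -rmorphM /= mulVf ?scale1r //.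
Qed.

End Positivity.

Section PositiveElements.
Context {R : realType} {A : cstarAlgType R}.
Implicit Types (a b c x y z : A) (s t : R).

Local Notation one := (@cone R A).
Local Notation "t ^&" := (t%:C%C : R[i]) (at level 2, format "t ^&").

(** Replaces the comparison of the spectra of c^* c and c c^*.  Write c^* c = - n^2 and
    d = c n.  Then d^* d = - n^4 and d d^* = - (c c^* )^2 are both negative, while their sum is
    positive by [norm_positive_star_sum]; so c c^* squares to 0. *)
Lemma star_cmul_neg_eq0 c : norm_positive (- (star c ** c)) -> c = 0.
Proof.
move=> /norm_positive_sqrt[n [[sn _] nn _]].
have ccN : star c ** c = - (n ** n) by rewrite nn opprK.
pose q := c ** star c; pose d := c ** n.
have sq : star q = q by rewrite starM starK.
have snn : star (n ** n) = n ** n by rewrite starM sn.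
have dd : star d ** d = - ((n ** n) ** (n ** n)).
  by rewrite starM sn -cmulA (cmulA (star c)) ccN cmulNl cmulNr !cmulA.
have dd' : d ** star d = - (q ** q).
  rewrite starM sn -cmulA (cmulA n) -(opprK (n ** n)) -ccN cmulNl cmulNr /q.
  by rewrite !cmulA.
have pq := norm_positive_sq sq.
have := norm_positive_star_sum d; rewrite dd dd' -opprD => pN.
have /(_ pN) sum0 := norm_positive_antisym (norm_positiveD (norm_positive_sq snn) pq).
have q0 : q ** q = 0.
  apply: norm_positive_antisym => //.
  have -> : - (q ** q) = (n ** n) ** (n ** n) by apply/esym/eqP; rewrite -addr_eq0 sum0.
  exact: norm_positive_sq.
have : star (star c) ** star c = 0 by rewrite starK; exact: sa_sq_eq0.
move=> h; have := normR_cmul_star (star c); rewrite h normR0 normR_star.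
by move/esym/eqP; rewrite sqrf_eq0 => /eqP; exact: normR0_eq0.
Qed.

(** With a = b^* b, h = |a| the root of a^2 and m = h - a twice the negative part, one
    has a m = - h m, so (b m)^* (b m) = m a m is negative.  Hence b m = 0, which gives
    m^2 = h m - a m = 0 and a = h. *)
Lemma norm_positive_star_cmul b : norm_positive (star b ** b).
Proof.
pose a := star b ** b; have sa : star a = a by rewrite starM starK.
have [h [ph hh commh]] := norm_positive_sqrt (norm_positive_sq sa).
have ah : a ** h = h ** a by apply: commh; rewrite cmulA.
have sh : star h = h by case: ph.
have [k [[sk _] kk commk]] := norm_positive_sqrt ph.
have ak : a ** k = k ** a by exact: commk.
have hk : h ** k = k ** h by exact: commk.
pose m := h - a.
have sm : star m = m by rewrite starB sh sa.
have mk : m ** k = k ** m by rewrite cmulBl cmulBr ak hk.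
have am : a ** m = - (h ** m) by rewrite !cmulBr hh ah opprB.
have bm0 : b ** m = 0.
  apply: star_cmul_neg_eq0.
  have -> : - (star (b ** m) ** (b ** m)) = (m ** k) ** (m ** k).
    rewrite starM sm -cmulA (cmulA (star b)) -/a am cmulNr opprK -kk.
    by rewrite [in RHS]mk [in LHS]cmulA [in LHS]cmulA mk !cmulA.
  apply: norm_positive_sq; by rewrite starM sk sm mk.
have am0 : a ** m = 0 by rewrite -cmulA bm0 cmul0r.
have hm0 : h ** m = 0 by rewrite -(opprK (h ** m)) -am am0 oppr0.
have m0 : m = 0 by apply: sa_sq_eq0 => //; rewrite {1}/m cmulBl hm0 am0 subrr.
by have -> : star b ** b = h by apply/esym/eqP; rewrite -subr_eq0 -/a -/m m0.
Qed.

Lemma positive_eltP a : positive_elt a <-> norm_positive a.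
Proof.
split=> [[b ->]|/norm_positive_sqrt[c [[sc _] cc _]]]; first exact: norm_positive_star_cmul.
by exists c; rewrite sc cc.
Qed.

(** For T = 1 + s L and |a| <= 1, the element T (a^* a) + s^2 (L a)^* (L a) exceeds
    (T a)^* (T a) by exactly s D_L(a, a).  Taking norms, |T|^2 <= |T| + s^2 |L|^2. *)
Lemma dissipation_tangent_contraction (L : {linear A -> A}) :
  bounded_operator L -> selfadjoint_map L ->
  (forall a, positive_elt (dissipation_map L a a)) -> tangent_contraction L.
Proof.
move=> bL saL disL; have [K K0 hK] := bounded_operator_pos bL.
exists (K ^+ 2) => [|s x s0]; first exact: exprn_ge0.
pose T : {linear A -> A} := sum_linear idfun (s^& \*: L).
have TE y : T y = y + s^& *: L y by [].
have bT : bounded_operator T.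
  exists (1 + s * K) => y; rewrite TE; apply: le_trans (ler_normRD _ _) _.
  rewrite mulrDl mul1r lerD2l normRZp // -mulrA; exact: ler_wpM2l.
pose M := opnorm T; pose c := K ^+ 2 * s ^+ 2.
have c0 : 0 <= c by rewrite mulr_ge0 ?exprn_ge0.
suff M1 : M <= 1 + c.
  rewrite -TE; apply: le_trans (opnorm_bound bT x) _.
  by apply: ler_wpM2r; rewrite ?normR_ge0.
have M0 : 0 <= M.
  by apply: le_trans (@opnorm_ge _ _ _ T bT 0 _); rewrite ?normR0 ?normR_ge0.
have key a : normR a <= 1 -> normR (T a) ^+ 2 <= M + c.
  move=> a1; pose z := star (T a) ** T a.
  pose w := T (star a ** a) + (s ^+ 2)^& *: (star (L a) ** L a).
  have sw : star w = w.
    have saa : star (star a ** a) = star a ** a by rewrite starM starK.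
    by rewrite starD starZr starM starK TE starD starZr saL // saa.
  have zw : w - z = s^& *: dissipation_map L a a.
    rewrite /w /z !TE starD starZr cmulDl !cmulDr !cmulZl !cmulZr scalerA -rmorphM /= -expr2.
    have cancel (p u v1 v2 r : A) : p + u + r - (p + v2 + (v1 + r)) = u - (v1 + v2).
      rewrite [p + v2 + _]addrA opprD addrACA subrr addr0.
      by rewrite -[p + v2 + v1]addrA opprD addrACA subrr add0r [v2 + v1]addrC.
    by rewrite /dissipation_map scalerBr scalerDr; exact: cancel.
  rewrite -normR_cmul_star; apply: (@le_trans _ _ (normR w)).
    apply: normR_mono => //; first exact: norm_positive_star_cmul.
    by rewrite zw; apply: norm_positiveZ => //; apply/positive_eltP.
  apply: le_trans (ler_normRD _ _) _; apply: lerD.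
    apply: le_trans (opnorm_bound bT _) _; rewrite normR_cmul_star -[leRHS]mulr1.
    apply: ler_wpM2l; last by rewrite expr_le1 ?normR_ge0.
    exact: M0.
  rewrite normRZp ?exprn_ge0 // normR_cmul_star /c mulrC; apply: ler_wpM2r; rewrite ?exprn_ge0 //.
  rewrite lerXn2r ?nnegrE ?normR_ge0 //; apply: le_trans (hK _) _.
  by rewrite -[leRHS]mulr1; apply: ler_wpM2l.
(* M is a supremum, so the bound on the squares is passed to it through a root. *)
have MM : M <= Num.sqrt (M + c).
  apply: opnorm_le => x' x1; rewrite -(ger0_norm (normR_ge0 (T x'))) -sqrtr_sqr.
  by apply: ler_wsqrtr; exact: key.
have : M ^+ 2 <= M + c.
  by rewrite -(@sqr_sqrtr _ (M + c)) ?addr_ge0 // lerXn2r ?nnegrE ?sqrtr_ge0.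
by rewrite leNgt => h; apply/negP => h'; nra.
Qed.

End PositiveElements.

(** * The C*-algebra of uniformly continuous functions *)

Section FunctionAlgebra.
Context {R : realType} {X : Type} (N : closeness R X) (A : cstarAlgType R).
Implicit Types f g h : buc N A.

Lemma bounded_uniformM f g : bounded_uniform N (fun x => f x ** g x).
Proof.
apply: (bounded_uniform_lift2 (@close_le _ _ N)) (bucP f) (bucP g) => M.
exists `|M| => // a b a' b' aM bM a'M b'M.
have -> : a ** b - a' ** b' = a ** (b - b') + (a - a') ** b'.
  by rewrite cmulBr cmulBl subrKA.
apply: le_trans (ler_normRD _ _) _; rewrite mulrDr [leRHS]addrC; apply: lerD.
  apply: le_trans (normR_cmul_le _ _) _; apply: ler_wpM2r; first exact: normR_ge0.
  exact: le_trans aM (ler_norm _).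
apply: le_trans (normR_cmul_le _ _) _; rewrite mulrC; apply: ler_wpM2r; first exact: normR_ge0.
exact: le_trans b'M (ler_norm _).
Qed.

Lemma bounded_uniform_star f : bounded_uniform N (fun x => star (f x)).
Proof.
have [[M hM] uf] := bucP f; split; first by exists M => x; rewrite normR_star.
by move=> e /uf[r r0 hr]; exists r => // x y /hr; rewrite -starB normR_star.
Qed.

Let mul f g : buc N A := Buc (bounded_uniformM f g).
Let one : buc N A := Buc (bounded_uniform_cst N cone).
Let adj f : buc N A := Buc (bounded_uniform_star f).

Let mulA : associative mul. Proof. by move=> f g h; apply: bucE => x; exact: cmulA. Qed.
Let mul1l : left_id one mul. Proof. by move=> f; apply: bucE => x; exact: cmul1l. Qed.
Let mul1r : right_id one mul. Proof. by move=> f; apply: bucE => x; exact: cmul1r. Qed.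
Let mulDl : left_distributive mul +%R.
Proof. by move=> f g h; apply: bucE => x; exact: cmulDl. Qed.
Let mulDr : right_distributive mul +%R.
Proof. by move=> f g h; apply: bucE => x; exact: cmulDr. Qed.
Let mulZl (c : R[i]) f g : mul (c *: f) g = c *: mul f g.
Proof. by apply: bucE => x; exact: cmulZl. Qed.
Let mulZr (c : R[i]) f g : mul f (c *: g) = c *: mul f g.
Proof. by apply: bucE => x; exact: cmulZr. Qed.
Let adjK : involutive adj. Proof. by move=> f; apply: bucE => x; exact: starK. Qed.
Let adjD : {morph adj : f g / f + g}.
Proof. by move=> f g; apply: bucE => x; exact: starD. Qed.
Let adjZ (c : R[i]) f : adj (c *: f) = conjc c *: adj f.
Proof. by apply: bucE => x; exact: starZ. Qed.
Let adjM f g : adj (mul f g) = mul (adj g) (adj f).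
Proof. by apply: bucE => x; exact: starM. Qed.
Let norm_mul_le f g : `|mul f g| <= `|f| * `|g|.
Proof.
rewrite !normRE -rmorphM lecR /=; apply: normR_buc_le => [|x].
  by rewrite mulr_ge0 ?normR_ge0.
by apply: le_trans (normR_cmul_le _ _) _; apply: ler_pM; rewrite ?normR_ge0 ?normR_buc_ge.
Qed.
Let norm_adj_mul f : `|mul (adj f) f| = `|f| ^+ 2.
Proof.
rewrite !normRE -rmorphXn /=; congr (_%:C)%C; apply/eqP; rewrite eq_le; apply/andP; split.
  apply: normR_buc_le => [|x]; first exact: exprn_ge0 (normR_ge0 _).
  by rewrite normR_cmul_star lerXn2r ?nnegrE ?normR_ge0 ?normR_buc_ge.
(* The supremum of the squares bounds the square of the supremum, by taking roots. *)
rewrite -(@sqr_sqrtr _ (normR (mul (adj f) f))) ?normR_ge0 //.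
rewrite lerXn2r ?nnegrE ?normR_ge0 ?sqrtr_ge0 //.
apply: normR_buc_le => [|x]; first exact: sqrtr_ge0.
rewrite -(ger0_norm (normR_ge0 (f x))) -sqrtr_sqr; apply: ler_wsqrtr.
by rewrite -normR_cmul_star; exact: normR_buc_ge (mul (adj f) f) x.
Qed.

HB.instance Definition _ := isCStarAlgebra.Build R (buc N A) mulA mul1l mul1r mulDl mulDr
  mulZl mulZr adjK adjD adjZ adjM norm_mul_le norm_adj_mul.

Lemma buc_starE f x : (star f) x = star (f x). Proof. by []. Qed.

End FunctionAlgebra.

Definition linear_map (K : pzRingType) (U W : lmodType K) (f : U -> W) (fL : linear f) :
  {linear U -> W} := HB.pack f (GRing.isLinear.Build K U W *:%R f fL).

(** * Dilation by translations *)

Section TranslationDilation.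
Context {R : realType} {d : Order.disp_t} {Omega : orderType d}.
Context {V : completeNormedModType R[i]} (A : Omega -> Omega -> {linear V -> V}).
Variable l : Omega -> Omega -> R.
Hypothesis A_additive : forall u v w, (u <= v)%O -> (v <= w)%O ->
  forall a, A u w a = A u v a + A v w a.
Hypothesis A_bounded : forall u v, (u <= v)%O -> bounded_operator (A u v).
Hypothesis A_tangent : forall u v, (u <= v)%O -> tangent_contraction (A u v).
Hypothesis l_ge0 : forall u v, (u <= v)%O -> 0 <= l u v.
Hypothesis l_superadditive : forall u v w, (u <= v)%O -> (v <= w)%O ->
  l u v + l v w <= l u w.
Hypothesis A_le : forall u v, (u <= v)%O -> forall a, normR (A u v a) <= l u v * normR a.
Implicit Types (u v : Omega) (S : Omega -> bool).

(** Closeness of S and S' is measured by the length of the interval in which they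
    differ. *)
Definition toggle_close (r : R) S S' :=
  exists u v, [/\ (u <= v)%O, l u v < r & S' = toggle u v S].

Lemma toggle_close_le r s S S' : r <= s -> toggle_close r S S' -> toggle_close s S S'.
Proof.
by move=> rs [u [v [uv h ->]]]; exists u, v; split=> //; exact: lt_le_trans h rs.
Qed.

Definition toggle_closeness := Closeness toggle_close_le.

Local Notation W := (buc toggle_closeness V).

Lemma bounded_uniform_translate u v (f : W) :
  bounded_uniform toggle_closeness (fun S => f (toggle u v S)).
Proof.
have [[M hM] uf] := bucP f; split; first by exists M => S.
move=> e /uf[r r0 hr]; exists r => // S S' [x [y [xy h ->]]].
by apply: hr; exists x, y; split=> //; exact: toggleC.
Qed.

Lemma translate_linear u v :
  linear (fun f : W => Buc (bounded_uniform_translate u v f) : W).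
Proof. by move=> c f g; exact: bucE. Qed.

Definition translate u v : {linear W -> W} := linear_map (translate_linear u v).

Lemma translateE u v (f : W) S : translate u v f S = f (toggle u v S).
Proof. by []. Qed.

Lemma translateK u v : involutive (translate u v).
Proof. by move=> f; apply: bucE => S; rewrite !translateE toggleK. Qed.

Lemma translate_isometric u v : isometric (translate u v).
Proof.
have le (f : W) : normR (translate u v f) <= normR f.
  by apply: normR_buc_le => [|S]; [exact: normR_ge0|rewrite translateE normR_buc_ge].
move=> f; apply/eqP; rewrite eq_le le /=.
by rewrite -{1}(translateK u v f) le.
Qed.

(** The empty set is the neutral element of the group, so this is evaluation at 1. *)
Definition eval_set0 : {linear W -> V} :=
  linear_map (fun (c : R[i]) (f g : W) => erefl : (c *: f + g) (fun=> false) = _).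

Lemma mass_bounded S : bounded_operator (mass A S).
Proof.
apply: (mass_ind (A := A) (P := fun f : V -> V => bounded_operator f)) => [|f g [K hK] [M hM]|//].
  by exists 0 => x; rewrite normR0 mul0r.
by exists (K + M) => x; apply: le_trans (ler_normRD _ _) _; rewrite mulrDl lerD.
Qed.

Lemma mass_tangent S : tangent_contraction (mass A S).
Proof.
apply: (mass_ind (A := A) (P := fun f : V -> V => tangent_contraction f)) => //.
- exact: tangent_contraction0.
- exact: tangent_contractionD.
Qed.

(** This is where geometric growth enters: translating S by [u, v) moves e^{A(S)} a by at
    most l(u, v) |a|, uniformly in S. *)
Lemma bounded_uniform_exp_mass a :
  bounded_uniform toggle_closeness (fun S => exp_operator (mass A S) a).
Proof.
split.
  by exists (normR a) => S; apply: exp_operator_contractive;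
    [exact: mass_bounded|exact: mass_tangent].
move=> e e0; have a1 : 0 < normR a + 1 by rewrite ltr_wpDl ?normR_ge0.
exists (e / (normR a + 1)); first by rewrite divr_gt0.
move=> S _ [u [v [uv luv ->]]].
have h : normR (exp_operator (mass A S) a - exp_operator (mass A (toggle u v S)) a) <=
    l u v * normR a.
  apply: exp_operator_lipschitz; try exact: mass_bounded; try exact: mass_tangent.
    exact: l_ge0.
  by move=> x; rewrite normRB; exact: mass_toggle_le.
apply: le_trans h _; move: luv; rewrite ltr_pdivlMr // => luv; apply: le_trans (ltW luv).
by apply: ler_wpM2l; [exact: l_ge0|rewrite lerDl].
Qed.

Lemma exp_mass_linear : linear (fun a => Buc (bounded_uniform_exp_mass a) : W).
Proof.
move=> c a b; apply: bucE => S; rewrite bucDE bucZE /=.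
by rewrite exp_operator_is_linear //; exact: mass_bounded.
Qed.

Definition exp_mass : {linear V -> W} := linear_map exp_mass_linear.

Lemma exp_massE a S : exp_mass a S = exp_operator (mass A S) a.
Proof. by []. Qed.

Lemma eval_exp_mass a : eval_set0 (exp_mass a) = a.
Proof.
apply: exp_operator_fixed; [exact: mass_bounded|exact: mass_set0].
Qed.

Lemma eval_translate_exp_mass u v a : (u <= v)%O ->
  eval_set0 (translate u v (exp_mass a)) = exp_operator (A u v) a.
Proof.
move=> uv; rewrite /= /exp_operator; congr (limn (series _)); apply: funext => n.
congr (_ *: _); elim: n => //= n ->; exact: mass_itv.
Qed.

Lemma exp_mass_isometric : isometric exp_mass.
Proof.
move=> a; apply/eqP; rewrite eq_le; apply/andP; split.
  apply: normR_buc_le => [|S]; first exact: normR_ge0.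
  by apply: exp_operator_contractive; [exact: mass_bounded|exact: mass_tangent].
rewrite -{1}(eval_exp_mass a); exact: normR_buc_ge.
Qed.

Lemma eval_contractive : contractive eval_set0.
Proof. by move=> f; exact: normR_buc_ge. Qed.

Lemma translate_refl u f : translate u u f = f.
Proof. by apply: bucE => S; rewrite translateE toggle_refl. Qed.

Lemma translate_trans u v w f : (u <= v)%O -> (v <= w)%O ->
  translate u w f = translate u v (translate v w f).
Proof. by move=> uv vw; apply: bucE => S; rewrite !translateE (toggle_trans _ uv vw). Qed.

End TranslationDilation.

(** [u', v') differs from [u, v) by the interval between u and u' and the one between v
    and v'. *)
Lemma toggle_min_max (d : Order.disp_t) (Omega : orderType d) (u v u' v' : Omega)
    (S : Omega -> bool) : (u <= v)%O -> (u' <= v')%O ->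
  toggle u' v' S = toggle (Order.min v v') (Order.max v v')
    (toggle (Order.min u u') (Order.max u u') (toggle u v S)).
Proof.
move=> uv uv'; apply: funext => t; rewrite /toggle -!addbA; congr (_ (+) _).
have itvE x y : (x <= y)%O -> itv_indicator x y t = (x <= t)%O (+) (y <= t)%O.
  rewrite /itv_indicator ltNge => xy; case: (leP y t) => [yt|_]; last by rewrite andbT addbF.
  by rewrite (le_trans xy yt).
have min_max x y : (Order.min x y <= t)%O (+) (Order.max x y <= t)%O =
    (x <= t)%O (+) (y <= t)%O.
  by rewrite ge_min ge_max; case: (x <= t)%O; case: (y <= t)%O.
rewrite !itvE ?min_max //; last 2 first.
- by rewrite le_max !ge_min lexx.
- by rewrite le_max !ge_min lexx.
by case: (u <= t)%O; case: (v <= t)%O; case: (u' <= t)%O; case: (v' <= t)%O.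
Qed.

Section StrongContinuity.
Context {R : realType} {d : Order.disp_t} {Omega : orderTopologicalType d}.
Context {V : completeNormedModType R[i]}.
Let E := [set p : Omega * Omega | (p.1 <= p.2)%O].
Variable l : Omega -> Omega -> R.
Hypothesis l_length : superadditive_length E l.

(** Continuity of l at the diagonal point (u, u), where it vanishes. *)
Lemma length_small u (r : R) : 0 < r ->
  \forall u' \near u, l (Order.min u u') (Order.max u u') < r.
Proof.
move=> r0; have [lc _ l0 _] := l_length.
have Euu : E (u, u) by rewrite /E /=.
have := (subspace_continuousP _ _).1 lc (u, u) Euu.
move=> /cvgrPdist_lt /(_ _ r0) [[Q1 Q2] /= [Qu1 Qu2] hQ].
near=> u'.
have small x y : (x <= y)%O -> Q1 x -> Q2 y -> l x y < r.
  move=> xy Qx Qy; have : `|l u u - l x y| < r := hQ (x, y) (conj Qx Qy) xy.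
  by rewrite l0 // sub0r normrN; apply: le_lt_trans; exact: ler_norm.
have Q1u' : Q1 u' by near: u'.
have Q2u' : Q2 u' by near: u'.
have [uu'|/ltW uu'] := leP u u'; apply: small => //; exact: nbhs_singleton.
Unshelve. all: by end_near. Qed.

Lemma translate_strongly_continuous :
  strongly_continuous E (@translate R d Omega V l).
Proof.
move=> f; apply/subspace_continuousP => -[u v] uv.
apply/cvg_normRP => e e0; have e20 : 0 < e / 2 by rewrite divr_gt0.
have [_ /(_ _ e20)[r r0 hr]] := bucP f.
exists ([set u' | l (Order.min u u') (Order.max u u') < r],
        [set v' | l (Order.min v v') (Order.max v v') < r]).
  by split; exact: length_small.
move=> [u' v'] /= [hu hv] uv'.
rewrite -[normR _]/(normR (translate l u v f - translate l u' v' f)).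
apply: normR_buc_le => [|S]; first exact: ltW.
rewrite bucDE bucNE !translateE (toggle_min_max S uv uv').
set S1 := toggle u v S; set S2 := toggle (Order.min u u') _ S1.
apply: le_trans (ler_normRBD _ (f S2) _) _; rewrite [e]splitr; apply: lerD; apply: hr.
  by exists (Order.min u u'), (Order.max u u'); split=> //; rewrite le_max !ge_min lexx.
by exists (Order.min v v'), (Order.max v v'); split=> //; rewrite le_max !ge_min lexx.
Qed.

End StrongContinuity.

(** * Dilations of generating families *)

Section Dilations.
Context {R : realType} {d : Order.disp_t} {Omega : orderTopologicalType d}.
Let E := [set p : Omega * Omega | (p.1 <= p.2)%O].

Lemma generating_family_edges (V : completeNormedModType R[i])
    (A : Omega -> Omega -> {linear V -> V}) : generating_family E A ->
  [/\ forall u v w, (u <= v)%O -> (v <= w)%O -> forall a, A u w a = A u v a + A v w a,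
      forall u v, (u <= v)%O -> bounded_operator (A u v)
    & exists2 l, superadditive_length E l &
        forall u v, (u <= v)%O -> forall a, normR (A u v a) <= l u v * normR a].
Proof.
move=> [bA _ addA [l l_length lA] _]; split.
- by move=> u v w uv vw; apply: addA => //; exact: le_trans uv vw.
- by move=> u v uv; exact: bA.
- exists l => // u v uv a; apply: le_trans (opnorm_bound (bA u v uv) a) _.
  by apply: ler_wpM2r; [exact: normR_ge0|exact: lA].
Qed.

Section Family.
Context {V : completeNormedModType R[i]} (A : Omega -> Omega -> {linear V -> V}).
Variable l : Omega -> Omega -> R.
Hypothesis A_additive : forall u v w, (u <= v)%O -> (v <= w)%O ->
  forall a, A u w a = A u v a + A v w a.
Hypothesis A_bounded : forall u v, (u <= v)%O -> bounded_operator (A u v).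
Hypothesis A_tangent : forall u v, (u <= v)%O -> tangent_contraction (A u v).
Hypothesis l_length : superadditive_length E l.
Hypothesis A_le : forall u v, (u <= v)%O -> forall a, normR (A u v a) <= l u v * normR a.

Lemma length_ge0 u v : (u <= v)%O -> 0 <= l u v.
Proof. by have [_ h _ _] := l_length; exact: h. Qed.

Lemma length_superadditive u v w : (u <= v)%O -> (v <= w)%O -> l u v + l v w <= l u w.
Proof.
by have [_ _ _ h] := l_length; move=> uv vw; apply: h => //; exact: le_trans uv vw.
Qed.

Lemma translate_divisible : divisible_system E (@translate _ _ _ V l).
Proof.
split.
- by move=> u v _; exists 1 => f; rewrite mul1r translate_isometric.
- by move=> u _ f; exact: translate_refl.
- by move=> u v w uv vw _ f; exact: translate_trans.
Qed.

Let r := exp_mass A_additive A_bounded A_tangent length_ge0 length_superadditive A_le.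

Lemma banach_dilation_translate : banach_dilation E (buc (toggle_closeness l) V) A.
Proof.
exists (translate l), (eval_set0 l), r; split.
- split; [exact: translate_divisible|exact: translate_strongly_continuous].
- move=> u v _; split; first exact: translate_isometric.
  by move=> f; exists (translate l u v f); exact: translateK.
- split; first exact: eval_contractive.
  by move=> a; exists (r a); exact: eval_exp_mass.
- split; [exact: exp_mass_isometric|exact: eval_exp_mass].
- by move=> u v uv a; exact: eval_translate_exp_mass.
Qed.

End Family.

Section CStarFamily.
Context {A : cstarAlgType R} (L : Omega -> Omega -> {linear A -> A}).
Variable l : Omega -> Omega -> R.
Hypothesis L_additive : forall u v w, (u <= v)%O -> (v <= w)%O ->
  forall a, L u w a = L u v a + L v w a.
Hypothesis L_bounded : forall u v, (u <= v)%O -> bounded_operator (L u v).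
Hypothesis l_length : superadditive_length E l.
Hypothesis L_le : forall u v, (u <= v)%O -> forall a, normR (L u v a) <= l u v * normR a.
Hypothesis L_selfadjoint : forall u v, (u <= v)%O -> selfadjoint_map (L u v).
Hypothesis L_unit : forall u v, (u <= v)%O -> L u v cone = 0.
Hypothesis L_dissipation : forall u v, (u <= v)%O ->
  forall a, positive_elt (dissipation_map (L u v) a a).

Lemma mass_selfadjoint S : selfadjoint_map (mass L S).
Proof.
apply: (mass_ind (A := L) (P := fun f : A -> A => selfadjoint_map f)) => //.
- by move=> a _; exact: star0.
- by move=> f g sf sg a sa; rewrite starD sf // sg.
Qed.

Lemma mass_unit S : mass L S cone = 0.
Proof.
apply: (mass_ind (A := L) (P := fun f : A -> A => f cone = 0)) => //.
by move=> f g -> ->; rewrite addr0.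
Qed.

Lemma exp_operator_selfadjoint (X : {linear A -> A}) : bounded_operator X ->
  selfadjoint_map X -> selfadjoint_map (exp_operator X).
Proof.
move=> bX sX a sa; have expX := @euler_cvg_exp _ _ X bX a.
apply: limit_unique (star_cvg expX) _.
rewrite (_ : star \o _ = (fun n => iter n.+1 (euler_step X n.+1%:R^-1) a)) //.
apply: funext => n; rewrite /comp; move: n.+1 (n.+1%:R^-1 : R) => m h.
elim: m => [//|m IH].
by rewrite iterS /euler_step starD starZr IH sX.
Qed.

Let L_tangent u v (uv : (u <= v)%O) : tangent_contraction (L u v) :=
  dissipation_tangent_contraction (L_bounded uv) (L_selfadjoint uv) (L_dissipation uv).

Let r := exp_mass L_additive L_bounded L_tangent (length_ge0 l_length)
  (length_superadditive l_length) L_le.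

Lemma exp_mass_unit : r cone = cone.
Proof.
apply: bucE => S; rewrite exp_massE.
by apply: exp_operator_fixed; [exact: mass_bounded|exact: mass_unit].
Qed.

(** r is unital and isometric, so |t - a| <= t gives |t - r a| <= t. *)
Lemma exp_mass_positive : positive_map r.
Proof.
move=> a /positive_eltP[sa [t t0 ta]]; apply/positive_eltP; split.
  apply: bucE => S; rewrite buc_starE exp_massE.
  by apply: exp_operator_selfadjoint => //; [exact: mass_bounded|exact: mass_selfadjoint].
exists t => //.
have -> : t%:C%C *: cone - r a = r (t%:C%C *: cone - a).
  have rB : r (t%:C%C *: cone - a) = t%:C%C *: r cone - r a by rewrite linearB linearZ.
  by rewrite rB exp_mass_unit.
by rewrite exp_mass_isometric.
Qed.

Lemma cstar_dilation_translate : cstar_dilation E (buc (toggle_closeness l) A) L.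
Proof.
exists (translate l), (eval_set0 l), r; split.
- split; [exact: translate_divisible|exact: translate_strongly_continuous].
- move=> u v _; split; last first.
    by exists (translate l u v); exact: translateK.
  by split=> [|f g|f]; exact: bucE.
- by split=> // a; exists (r a); exact: eval_exp_mass.
- split; [exact: exp_mass_isometric|exact: exp_mass_positive|exact: exp_mass_unit|].
  exact: eval_exp_mass.
- by move=> u v uv a; exact: eval_translate_exp_mass.
Qed.

End CStarFamily.

End Dilations.

Theorem theorem1p9 (R : realType) (d : Order.disp_t)
    (Omega : orderTopologicalType d) (Omega_neq0 : [set: Omega] !=set0)
    (E : set (Omega * Omega))
    (E_le : E = [set p | (p.1 <= p.2)%O]) :
  (forall (V : completeNormedModType R[i])
          (A : Omega -> Omega -> {linear V -> V}),
     generating_family E A ->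
     (forall u v, E (u, v) -> dissipative (A u v)) ->
     exists W : completeNormedModType R[i], banach_dilation E W A)
  /\
  (forall (A : cstarAlgType R) (L : Omega -> Omega -> {linear A -> A}),
     generating_family E L ->
     (forall u v, E (u, v) ->
        [/\ selfadjoint_map (L u v), L u v cone = 0
          & forall a, positive_elt (dissipation_map (L u v) a a)]) ->
     (exists B : cstarAlgType R, cstar_dilation E B L)
     /\
     (commutative_alg A ->
      exists2 B : cstarAlgType R,
        commutative_alg B & cstar_dilation E B L)).
Proof.
subst E; split=> [V A /generating_family_edges[addA bA [l l_length A_le]] dA|A L].
  exists (buc (toggle_closeness l) V); apply: banach_dilation_translate => // u v uv.
  by apply: dissipative_tangent_contraction; [exact: bA|exact: dA].
move=> /generating_family_edges[addL bL [l l_length L_le]] hL.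
have dil : cstar_dilation [set p : Omega * Omega | (p.1 <= p.2)%O]
    (buc (toggle_closeness l) A) L.
  by apply: cstar_dilation_translate => // u v /(hL u v)[].
split; first by exists (buc (toggle_closeness l) A).
move=> cA; exists (buc (toggle_closeness l) A) => // f g.
by apply: bucE => S; exact: cA.
Qed.
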